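(* For every integer $n\ge1$ there exists an (explicit) bijection $\Psi$ from the set $\mathcal{D}^2_n$ of $2$-fans of Dyck paths of semilength $n$ to the set of $3$-noncrossing perfect matchings on $[2n]=\{1,\dots,2n\}$ that intertwines promotion and rotation, i.e. $$\Psi(\mathrm{Pr}(\mathcal{F}))=\mathrm{rot}(\Psi(\mathcal{F}))\qquad\text{for all }\mathcal{F}\in\mathcal{D}^2_n .$$
   Context: A Dyck path of semilength $n$ is a lattice walk from $(0,0)$ to $(n,n)$ with unit north and east steps staying weakly above the line $x=y$; it is encoded by its heights $(d_0=0,d_1,\dots,d_{2n}=0)$, where $d_i\ge0$ is the number of north steps minus the number of east steps among the first $i$ steps. For Dyck paths $D,D'$ write $D\le D'$ if $d_i\le d_i'$ for all $i$. An $m$-fan of Dyck paths of semilength $n$ is a tuple $(D_m,D_{m-1},\dots,D_1)$ of Dyck paths of semilength $n$ with $D_1\le D_2\le\dots\le D_m$; the set of these is $\mathcal{D}^m_n$. Such a fan $\mathcal{F}$ is encoded by vectors $(\mu^0,\mu^1,\dots,\mu^{2n})$, where $\mu^i=(\mu^i_m,\dots,\mu^i_1)\in\mathbb{Z}_{\ge0}^m$ is the weakly decreasing vector whose entry $\mu^i_k$ is the $i$th height of $D_k$; here $\mu^0=\mu^{2n}=0$. For $\rho\in\mathbb{Z}^m$, $\mathrm{dom}(\rho)$ is the vector obtained by sorting the absolute values of the entries of $\rho$ in weakly decreasing order. For $1\le i\le 2n-1$, $\mathrm{BK}_i(\mathcal{F})$ is the fan obtained from $\mathcal{F}$ by replacing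 $\mu^i$ with $\mathrm{dom}(\mu^{i-1}+\mu^{i+1}-\mu^i)$ and keeping all other $\mu^j$; each $\mathrm{BK}_i$ is a well-defined involution on $\mathcal{D}^m_n$. Promotion of fans is $\mathrm{Pr}:=\mathrm{BK}_{2n-1}\cdot\mathrm{BK}_{2n-2}\cdots\mathrm{BK}_1$ (composition of maps, $\mathrm{BK}_1$ applied first). A perfect matching on $[2n]$ is a partition of $[2n]$ into $n$ pairs. It is $3$-noncrossing if it contains no three pairs $\{i_1,j_1\},\{i_2,j_2\},\{i_3,j_3\}$ with $i_1<i_2<i_3<j_1<j_2<j_3$. Rotation $\mathrm{rot}$ acts on perfect matchings by the cyclic relabeling $i\mapsto i-1$ of $[2n]$, with $1\mapsto 2n$. *)

(* Defs.v *)
From mathcomp Require Import all_boot all_order all_algebra.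
From mathcomp Require Import zify.

Set Implicit Arguments.
Unset Strict Implicit.
Unset Printing Implicit Defensive.

Import Order.TTheory GRing.Theory Num.Theory.
Local Open Scope ring_scope.

(* A walk is a sequence of unit steps, [true] being north and [false] east. *)
Definition norths (w : seq bool) (i : nat) : nat := count_mem true (take i w).
Definition easts (w : seq bool) (i : nat) : nat := count_mem false (take i w).

Definition is_dyck (n : nat) (w : n.*2.-tuple bool) : bool :=
  [&& easts w n.*2 == n, norths w n.*2 == n &
      [forall i : 'I_n.*2.+1, (easts w i <= norths w i)%N]].

Definition dyck (n : nat) := {w : n.*2.-tuple bool | is_dyck w}.

Definition height (n : nat) (D : dyck n) (i : nat) : int :=
  (norths (val D) i)%:Z - (easts (val D) i)%:Z.

Definition dyck_le (n : nat) (D D' : dyck n) : bool :=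
  [forall i : 'I_n.*2.+1, height D i <= height D' i].

(* Fans are listed as (D_m, ..., D_1), so the largest path has index 0. *)
Definition is_fan (m n : nat) (F : m.-tuple (dyck n)) : bool :=
  sorted (fun D D' => dyck_le D' D) F.

Definition fan (m n : nat) := {F : m.-tuple (dyck n) | is_fan F}.

Definition mu (m n : nat) (F : fan m n) (i : nat) : 'rV[int]_m :=
  \row_k height (tnth (val F) k) i.

Definition dom (m : nat) (r : 'rV[int]_m) : 'rV[int]_m :=
  \row_k (nth 0%N (sort geq [seq `|r ord0 l|%N | l <- enum 'I_m]) k)%:Z.

(* The default value [F] is never used for 0 < i < 2n, and the fan picked is
   then unique: see [mu_BK] and [mu_inj] below. *)
Definition BK (m n : nat) (i : nat) (F : fan m n) : fan m n :=
  odflt F [pick F' : fan m n | [forall j : 'I_n.*2.+1,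
    mu F' j == if j == i :> nat then dom (mu F i.-1 + mu F i.+1 - mu F i)
               else mu F j]].

(* [foldl] over 1, ..., 2n-1: BK 1 is applied first. *)
Definition Pr (m n : nat) (F : fan m n) : fan m n :=
  foldl (fun G i => BK i G) F (iota 1 n.*2.-1).

Lemma norths_easts (w : seq bool) (i : nat) :
  (i <= size w)%N -> (norths w i + easts w i)%N = i.
Proof.
move=> iw; rewrite /norths /easts -[RHS](size_takel iw) -(count_predC (pred1 true)).
by congr addn; apply: eq_count; case.
Qed.

Lemma heightS (n : nat) (D : dyck n) (i : nat) : (i < n.*2)%N ->
  height D i.+1 = height D i + (if nth false (val D) i then 1 else -1).
Proof.
move=> lti; rewrite /height /norths /easts (take_nth false) ?size_tuple //.
by rewrite -!cats1 !count_cat /=; case: (nth _ _ _) => /=; lia.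
Qed.

Lemma height0 (n : nat) (D : dyck n) : height D 0 = 0.
Proof. by rewrite /height /norths /easts take0. Qed.

Lemma height_last (n : nat) (D : dyck n) : height D n.*2 = 0.
Proof. by case: D => w; rewrite /height /= => /and3P[/eqP -> /eqP -> _]; lia. Qed.

Lemma height_ge0 (n : nat) (D : dyck n) (i : nat) : (i <= n.*2)%N -> 0 <= height D i.
Proof.
case: D => w dw lei; rewrite /height /=; case/and3P: (dw) => _ _ /forallP.
by move/(_ (Ordinal (lei : (i < n.*2.+1)%N))) => /=; lia.
Qed.

Lemma height_odd (n : nat) (D : dyck n) (i : nat) :
  (i <= n.*2)%N -> odd `|height D i|%N = odd i.
Proof.
move=> lei; have := height_ge0 D lei.
have := @norths_easts (val D) i; rewrite size_tuple => /(_ lei).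
by rewrite /height; lia.
Qed.

Lemma height_inj (n : nat) (D D' : dyck n) :
  (forall i, (i <= n.*2)%N -> height D i = height D' i) -> D = D'.
Proof.
move=> eqh; apply/val_inj/val_inj/(@eq_from_nth _ false); rewrite ?size_tuple //.
move=> i lti; have := eqh _ lti; rewrite !heightS // eqh; last exact: ltnW.
by do 2![case: (nth _ _ _)] => //; lia.
Qed.

Lemma dyck_of_height (n : nat) (d : nat -> int) :
  d 0%N = 0 -> d n.*2 = 0 -> (forall i, (i <= n.*2)%N -> 0 <= d i) ->
  (forall i, (i < n.*2)%N -> `|d i.+1 - d i| = 1) ->
  exists D : dyck n, forall i, (i <= n.*2)%N -> height D i = d i.
Proof.
move=> d0 dl dge dS; pose w := mktuple (fun i : 'I_n.*2 => d i < d i.+1).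
have ht i : (i <= n.*2)%N -> (norths w i)%:Z - (easts w i)%:Z = d i.
  elim: i => [|i IHi] lei; first by rewrite /norths /easts take0 d0.
  have := IHi (ltnW lei); rewrite /norths /easts.
  rewrite (take_nth false) ?size_tuple // -!cats1 !count_cat /=.
  have -> : nth false w i = (d i < d i.+1).
    by have := tnth_mktuple (fun i : 'I_n.*2 => d i < d i.+1) (Ordinal lei);
      rewrite (tnth_nth false).
  by have := dS i lei; case: (ltP (d i) (d i.+1)) => /=; lia.
have ne i : (i <= n.*2)%N -> (norths w i + easts w i)%N = i.
  by move=> lei; apply: norths_easts; rewrite size_tuple.
have dw : is_dyck w.
  have := ht _ (leqnn _); have := ne _ (leqnn _); rewrite dl => e1 e2.
  apply/and3P; split; [lia|lia|apply/forallP => i].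
  have lei : (i <= n.*2)%N by rewrite -ltnS.
  by have := ht i lei; have := dge i lei; lia.
by exists (exist _ w dw) => i lei; rewrite /height /= ht.
Qed.

Lemma mu_inj (m n : nat) (F F' : fan m n) :
  (forall i, (i <= n.*2)%N -> mu F i = mu F' i) -> F = F'.
Proof.
move=> eqmu; apply/val_inj/eq_from_tnth => k; apply: height_inj => i lei.
by have /rowP/(_ k) := eqmu i lei; rewrite !mxE.
Qed.

Lemma mu_sorted (m n : nat) (F : fan m n) (i : nat) (k l : 'I_m) :
  (i <= n.*2)%N -> (k <= l)%N -> mu F i ord0 l <= mu F i ord0 k.
Proof.
move=> lei lekl; rewrite !mxE; case: F => F sF /=.
have tr : transitive (fun D D' : dyck n => dyck_le D' D).
  move=> D2 D1 D3 /forallP le21 /forallP le32; apply/forallP => j.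
  exact: le_trans (le32 j) (le21 j).
have rf : reflexive (fun D D' : dyck n => dyck_le D' D).
  by move=> D; apply/forallP.
pose D0 := tnth F k.
have := sorted_leq_nth tr rf D0 sF; move/(_ k l); rewrite !inE size_tuple !ltn_ord.
move=> /(_ isT isT lekl); rewrite -!tnth_nth => /forallP.
by move/(_ (Ordinal (lei : (i < n.*2.+1)%N))).
Qed.

Lemma fan_of_mu (m n : nat) (v : nat -> 'rV[int]_m) :
  v 0%N = 0 -> v n.*2 = 0 ->
  (forall i k, (i <= n.*2)%N -> 0 <= v i ord0 k) ->
  (forall i k, (i < n.*2)%N -> `|v i.+1 ord0 k - v i ord0 k| = 1) ->
  (forall i (k l : 'I_m), (i <= n.*2)%N -> (k <= l)%N -> v i ord0 l <= v i ord0 k) ->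
  exists F : fan m n, forall i, (i <= n.*2)%N -> mu F i = v i.
Proof.
move=> v0 vl vge vS vs.
have ex k : exists D : dyck n,
    [forall i : 'I_n.*2.+1, height D i == v i ord0 k].
  case: (@dyck_of_height n (fun i => v i ord0 k)).
  - by rewrite v0 mxE.
  - by rewrite vl mxE.
  - by move=> i; apply: vge.
  - by move=> i; apply: vS.
  move=> D hD; exists D; apply/forallP => i; apply/eqP; apply: hD.
  by rewrite -ltnS.
pose F := mktuple (fun k : 'I_m => xchoose (ex k)).
have hF i k : (i <= n.*2)%N -> height (tnth F k) i = v i ord0 k.
  move=> lei; rewrite tnth_mktuple; have /forallP := xchooseP (ex k).
  by move/(_ (Ordinal (lei : (i < n.*2.+1)%N)))/eqP.
have sF : is_fan F.
  rewrite /is_fan; have [m0|mpos] := posnP m.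
    by have /size0nil -> : size F = 0%N by rewrite size_tuple.
  pose D0 := tnth F (Ordinal mpos); apply/(sortedP D0) => k; rewrite size_tuple => ltk.
  have ltk' := ltnW ltk.
  rewrite -(tnth_nth D0 F (Ordinal ltk)) -(tnth_nth D0 F (Ordinal ltk')).
  apply/forallP => i; have lei : (i <= n.*2)%N by rewrite -ltnS.
  by rewrite !hF //; apply: vs => //=.
exists (exist _ F sF) => i lei; apply/rowP => k; rewrite mxE; exact: hF.
Qed.

Lemma nth_sort_geq (s : seq nat) (x k : nat) : (k < size s)%N ->
  (x <= nth 0 (sort geq s) k)%N = (k < count (leq x) s)%N.
Proof.
move=> ltk; rewrite -(count_sort geq (leq x) s) -(size_sort geq s) in ltk *.
have tg : transitive geq by move=> a b c; rewrite /geq /= => h1 h2; lia.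
have ss : sorted geq (sort geq s).
  by apply: sort_sorted => a b; rewrite /geq /=; lia.
elim: (sort geq s) k ltk ss => // a t IHt [|k] /= ltk pt.
  case: (leqP x a) => //= ltxa.
  symmetry; apply/negbTE; rewrite add0n -eqn0Ngt; apply/eqP.
  rewrite (@eq_in_count _ _ pred0) ?count_pred0 // => b bt /=.
  have := order_path_min tg pt => /allP/(_ b bt); rewrite /geq /=; lia.
rewrite IHt //; last exact: path_sorted pt.
case: (leqP x a) => //= ltxa; rewrite add0n.
suff -> : count (leq x) t = 0%N by [].
rewrite (@eq_in_count _ _ pred0) ?count_pred0 // => b bt /=.
have := order_path_min tg pt => /allP/(_ b bt); rewrite /geq /=; lia.
Qed.

Lemma dom_ge0 (m : nat) (r : 'rV[int]_m) (k : 'I_m) : 0 <= dom r ord0 k.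
Proof. by rewrite mxE. Qed.

Lemma dom_sorted (m : nat) (r : 'rV[int]_m) (k l : 'I_m) :
  (k <= l)%N -> dom r ord0 l <= dom r ord0 k.
Proof.
move=> lekl; rewrite !mxE lez_nat nth_sort_geq; last first.
  by rewrite size_map size_enum_ord.
apply: leq_ltn_trans lekl _.
by rewrite -nth_sort_geq // size_map size_enum_ord.
Qed.

Lemma dom_dist (m : nat) (p : bool) (a r : 'rV[int]_m) :
  (forall k l : 'I_m, (k <= l)%N -> a ord0 l <= a ord0 k) ->
  (forall k, 0 <= a ord0 k) ->
  (forall k, odd `|a ord0 k|%N = p) ->
  (forall k, `|r ord0 k - a ord0 k| = 1) ->
  forall k, `|dom r ord0 k - a ord0 k| = 1.
Proof.
move=> sa a0 oa ra k; rewrite mxE.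
set s := [seq _ | l <- _]; set y := nth _ _ _.
have sz : size s = m by rewrite size_map size_enum_ord.
have ys : y \in s by rewrite -(mem_sort geq) mem_nth // size_sort sz.
have oy : odd y = ~~ p.
  have /mapP[l _ ->] := ys; have := oa l; have := ra l; have := a0 l; lia.
pose t := [seq `|a ord0 l|%N | l <- enum 'I_m].
have lo x : (x <= y)%N = (k < count (leq x) s)%N by rewrite -nth_sort_geq ?sz.
have nt (l : 'I_m) : nth 0%N t l = `|a ord0 l|%N.
  by rewrite (nth_map l) ?size_enum_ord // nth_ord_enum.
have st : sort geq t = t.
  apply: sorted_sort; first by move=> x z w; rewrite /geq /=; lia.
  apply/(sortedP 0%N) => i; rewrite size_map size_enum_ord => lti.
  have lti' := ltnW lti; pose k0 := Ordinal lti; pose k1 := Ordinal lti'.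
  rewrite (nt k0) (nt k1) /geq /=.
  by have := @sa k1 k0 (leqnSn i); have := a0 k1; have := a0 k0; lia.
have la x : (x <= `|a ord0 k|)%N = (k < count (leq x) t)%N.
  have szt : size t = m by rewrite size_map size_enum_ord.
  by rewrite -nth_sort_geq ?szt // st nt.
have h1 : (`|a ord0 k|.-1 <= y)%N.
  rewrite lo; have := la `|a ord0 k|%N; rewrite leqnn => /esym lt.
  apply: leq_trans lt _; rewrite !count_map; apply: sub_count => l /=.
  have := ra l; have := a0 l; lia.
have h2 : (y.-1 <= `|a ord0 k|)%N.
  rewrite la; have := lo y; rewrite leqnn => /esym lt.
  apply: leq_trans lt _; rewrite !count_map; apply: sub_count => l /=.
  have := ra l; have := a0 l; lia.
have := oa k; have := a0 k; lia.
Qed.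

Lemma mu_BK (m n : nat) (i : nat) (F : fan m n) (j : nat) :
  (0 < i < n.*2)%N -> (j <= n.*2)%N ->
  mu (BK i F) j =
    if j == i then dom (mu F i.-1 + mu F i.+1 - mu F i) else mu F j.
Proof.
move=> /andP[i0 lti] lej; set r := _ - _.
pose v j := if j == i then dom r else mu F j.
have lei1 : (i.-1 <= n.*2)%N by lia.
have stepS h k : (h < n.*2)%N -> `|mu F h.+1 ord0 k - mu F h ord0 k| = 1.
  by move=> lth; rewrite !mxE heightS //; case: ifP; lia.
have mu0 h k : (h <= n.*2)%N -> 0 <= mu F h ord0 k.
  by move=> leh; rewrite mxE height_ge0.
have oddmu h k : (h <= n.*2)%N -> odd `|mu F h ord0 k|%N = odd h.
  by move=> leh; rewrite mxE height_odd.
have st1 k : `|mu F i ord0 k - mu F i.-1 ord0 k| = 1.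
  by rewrite -{1}(prednK i0) stepS //; lia.
have rE k : r ord0 k = mu F i.-1 ord0 k + mu F i.+1 ord0 k - mu F i ord0 k.
  by rewrite !mxE.
have [G hG] : exists G : fan m n, forall j, (j <= n.*2)%N -> mu G j = v j.
  apply: fan_of_mu; rewrite /v.
  - by rewrite eq_sym (gtn_eqF i0); apply/rowP => k; rewrite !mxE height0.
  - by rewrite (gtn_eqF lti); apply/rowP => k; rewrite !mxE height_last.
  - by move=> h k leh; case: ifP => _; [exact: dom_ge0 | exact: mu0].
  - move=> h k lth; case: (eqVneq h.+1 i) => [hi|_].
      have -> : (h == i) = false by lia.
      have -> : h = i.-1 by lia.
      apply: (@dom_dist m (odd i.-1)).
      + by move=> *; apply: mu_sorted.
      + by move=> *; apply: mu0.
      + by move=> *; apply: oddmu.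
      + by move=> l; rewrite rE; have := stepS i l lti; lia.
    case: (eqVneq h i) => [->|_]; last exact: stepS.
    rewrite distrC; apply: (@dom_dist m (odd i.+1)).
    + by move=> *; apply: mu_sorted.
    + by move=> *; apply: mu0.
    + by move=> *; apply: oddmu.
    + by move=> l; rewrite rE; have := st1 l; lia.
  - move=> h k l leh lekl; case: ifP => _; [exact: dom_sorted | exact: mu_sorted].
rewrite /BK; case: pickP => [F' /forallP /= hF'|/(_ G) /forallP []] /=.
  by have /eqP := hF' (Ordinal (lej : (j < n.*2.+1)%N)).
by move=> h; apply/eqP; apply: hG; rewrite -ltnS.
Qed.

(* The element i of {1, ..., 2n} is represented by the ordinal i - 1. *)

Definition perfect_matching (n : nat) (M : {set {set 'I_n.*2}}) : bool :=
  partition M [set: 'I_n.*2] && [forall B in M, #|B| == 2%N].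

Definition crossing3 (n : nat) (M : {set {set 'I_n.*2}}) : bool :=
  [exists i1 : 'I_n.*2, exists i2 : 'I_n.*2, exists i3 : 'I_n.*2,
   exists j1 : 'I_n.*2, exists j2 : 'I_n.*2, exists j3 : 'I_n.*2,
    [&& (i1 < i2 < i3)%N, (i3 < j1)%N, (j1 < j2 < j3)%N,
        [set i1; j1] \in M, [set i2; j2] \in M & [set i3; j3] \in M]].

Definition matching3 (n : nat) :=
  {M : {set {set 'I_n.*2}} | perfect_matching M && ~~ crossing3 M}.

(* [ord_pred] is i |-> i - 1 modulo 2n, so the first point goes to the last. *)
Definition rot_set (n : nat) (M : {set {set 'I_n.*2}}) : {set {set 'I_n.*2}} :=
  [set @ord_pred _ @: (B : {set 'I_n.*2}) | B in M].

Lemma rot_set_subproof (n : nat) (M : matching3 n) :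
  perfect_matching (rot_set (val M)) && ~~ crossing3 (rot_set (val M)).
Proof.
case: M => M /= /andP[/andP[partM /forall_inP M2] ncM].
have inj1 := @ord_pred_inj n.*2.
have injS : injective (fun B : {set 'I_n.*2} => @ord_pred _ @: B) by apply: imset_inj.
apply/andP; split.
  apply/andP; split; last first.
    apply/forall_inP => _ /imsetP[B BM ->].
    by rewrite card_imset //; exact: M2.
  have -> : [set: 'I_n.*2] = @ord_pred _ @: [set: 'I_n.*2].
    by apply/setP => x; rewrite inE -[x]ordSK imset_f.
  by rewrite imset_partition.
apply: contra ncM.
have pairP (x y : 'I_n.*2) : [set x; y] \in rot_set M -> [set ordS x; ordS y] \in M.
  move=> /imsetP[B BM eqB].
  suff -> : [set ordS x; ordS y] = B by [].
  apply: injS => /=; rewrite -eqB imsetU1 imset_set1 !ordSK //.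
have valS (x : 'I_n.*2) : (x.+1 < n.*2)%N -> ordS x = x.+1 :> nat.
  by move=> xlt /=; rewrite modn_small.
move=> /existsP[i1 /existsP[i2 /existsP[i3 /existsP[j1 /existsP[j2 /existsP[j3]]]]]].
case/and5P=> /andP[l1 l2] l3 /andP[l4 l5] /pairP m1 /andP[/pairP m2 /pairP m3].
have := ltn_ord j3; rewrite leq_eqVlt => /orP[/eqP j3E|j3lt].
- apply/existsP; exists (ordS j3); apply/existsP; exists (ordS i1).
  apply/existsP; exists (ordS i2); apply/existsP; exists (ordS i3).
  apply/existsP; exists (ordS j1); apply/existsP; exists (ordS j2).
  have -> : [set ordS j3; ordS i3] = [set ordS i3; ordS j3] by rewrite setUC.
  have v0 : ordS j3 = 0%N :> nat by rewrite /= j3E modnn.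
  by rewrite m1 m2 m3 v0 !valS; lia.
- apply/existsP; exists (ordS i1); apply/existsP; exists (ordS i2).
  apply/existsP; exists (ordS i3); apply/existsP; exists (ordS j1).
  apply/existsP; exists (ordS j2); apply/existsP; exists (ordS j3).
  by rewrite m1 m2 m3 !valS; lia.
Qed.

Definition rot_matching (n : nat) (M : matching3 n) : matching3 n :=
  exist _ (rot_set (val M)) (rot_set_subproof M).

(* Main.v *)
Require Import Defs.
From mathcomp Require Import all_boot all_order all_algebra.
From mathcomp Require Import zify.

Set Implicit Arguments.
Unset Strict Implicit.
Unset Printing Implicit Defensive.

Import GRing.Theory Num.Theory.

(** In the coordinates l1 = (mu1 + mu2) / 2 and l2 = (mu1 - mu2) / 2, a 2-fan is a closed walk
among the partitions with at most two rows that adds or removes one box at each step, and [dom]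
still sorts the absolute values of the coordinates. The bijection is best described from matchings to
fans: cut the circle before the first point and after j points, look at the N chords that cross the
cut, and let L be the greatest number of pairwise noncrossing ones among them. The heights at j are
N and 2 L - N, i.e. (l1, l2) = (L, N - L), which is the shape given by Schensted insertion. The lower
height is nonnegative because, without 3-crossings, two noncrossing families cover the N chords.

Promotion is rotation. The same two numbers are defined for the cut along any interval of the
circle, and those of the rotated matching come from the intervals that start at the second point.
Everything thus reduces to a local rule for the four intervals obtained by including or not a first
point and a point after the last one ([local_rule]). Only the chords of these two points distinguish
the four cuts. Chords across a cut are points in the plane for which noncrossing means comparable,
and the rule says how the length of a longest chain reacts to two points on the border of the
box; it follows from two exchange arguments on pairs of chains ([exchange], [splice]) in the
lemmas [square_opposite] and [square_adjacent].

Injectivity is a consequence ([encodes_inj]): a fan and its promotion determine the partner of the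
first point, and the fans of all rotations are known.

Surjectivity ([diagram_ex]) inverts Schensted insertion: along the walk, a tableau of the current
shape records the openers of the open chords; when a box is added, the current point is a new
entry, and when a box is removed, the letter that leaves the tableau by inverse insertion is the
partner of the current point. *)

(** * Longest chains for a relation *)

Section Chains.

Variables (T : finType) (r : rel T).
Implicit Types (S X Y : {set T}) (x y : T).

Definition chain S := [forall x in S, forall y in S, (x != y) ==> r x y].

Definition maxchain X := \max_(S : {set T} | (S \subset X) && chain S) #|S|.

Lemma chainP S :
  reflect (forall x y, x \in S -> y \in S -> x != y -> r x y) (chain S).
Proof.
apply: (iffP forall_inP) => [h x y xS yS|h x xS].
  by have /forall_inP/(_ y yS)/implyP := h x xS.
by apply/forall_inP => y yS; apply/implyP; exact: h.
Qed.

Lemma chain_sub S S' : chain S -> S' \subset S -> chain S'.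
Proof.
move=> /chainP ch /subsetP sub; apply/chainP => x y xS yS.
by apply: ch; apply: sub.
Qed.

Lemma leq_maxchain S X : S \subset X -> chain S -> #|S| <= maxchain X.
Proof.
by move=> sS cS; rewrite /maxchain (bigmax_sup S) // sS cS.
Qed.

Lemma maxchain_leq X k :
  (forall S, S \subset X -> chain S -> #|S| <= k) -> maxchain X <= k.
Proof. by move=> h; apply/bigmax_leqP => S /andP[]; exact: h. Qed.

Lemma maxchain_ex X : exists S, [/\ S \subset X, chain S & #|S| = maxchain X].
Proof.
have P0 : (set0 \subset X) && chain set0.
  by rewrite sub0set; apply/chainP => x y; rewrite inE.
have P1 : 0 < #|[pred S : {set T} | (S \subset X) && chain S]| by apply/card_gt0P; exists set0.
have [S /andP[sS cS] eS] := eq_bigmax_cond (fun S : {set T} => #|S|) P1.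
by exists S; rewrite /maxchain eS.
Qed.

Lemma maxchain_card X : maxchain X <= #|X|.
Proof. by apply: maxchain_leq => S sS _; exact: subset_leq_card. Qed.

Lemma maxchain0 : maxchain set0 = 0.
Proof. by apply/eqP; rewrite -leqn0 -(cards0 T) maxchain_card. Qed.

Lemma maxchain_sub X Y : X \subset Y -> maxchain X <= maxchain Y.
Proof.
move=> sXY; apply: maxchain_leq => S sS; apply: leq_maxchain.
exact: subset_trans sXY.
Qed.

Lemma maxchain_full X : chain X -> maxchain X = #|X|.
Proof.
by move=> cX; apply/eqP; rewrite eqn_leq maxchain_card leq_maxchain.
Qed.

Lemma chainU1 x S : chain S -> (forall y, y \in S -> r x y) ->
  (forall y, y \in S -> r y x) -> chain (x |: S).
Proof.
move=> /chainP cS h1 h2; apply/chainP => y z.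
case/setU1P => [->|yS] /setU1P[->|zS]; rewrite ?eqxx // => ne.
- exact: h1.
- exact: h2.
- exact: cS.
Qed.

Lemma subU1_inv x S X : S \subset x |: X -> S :\ x \subset X.
Proof. by rewrite subDset. Qed.

Lemma maxchainU1 x X : maxchain (x |: X) <= (maxchain X).+1.
Proof.
apply: maxchain_leq => S sS cS; rewrite (cardsD1 x).
have : #|S :\ x| <= maxchain X.
  by apply: leq_maxchain; [exact: subU1_inv | apply: (chain_sub cS); rewrite subsetDl].
by case: (x \in S) => /=; lia.
Qed.

Lemma maxchainU1_ex x X : maxchain (x |: X) = (maxchain X).+1 ->
  exists S, [/\ S \subset X, chain S, #|S| = maxchain X & forall y, y \in S -> r x y].
Proof.
move=> e; have [S [sS cS cardS]] := maxchain_ex (x |: X).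
have cS' : chain (S :\ x) by apply: (chain_sub cS); rewrite subsetDl.
have le := leq_maxchain (subU1_inv sS) cS'.
have := cardsD1 x S; case: (boolP (x \in S)) => xS c; last by lia.
exists (S :\ x); split => //; [exact: subU1_inv | lia | move=> y].
by rewrite !inE => /andP[yx yS]; move/chainP: cS => /(_ x y xS yS); rewrite eq_sym; apply.
Qed.

Lemma maxchainU1_sym x X : (forall y, y \in X -> r x y = r y x) -> x \notin X ->
  maxchain (x |: X) = maxn (maxchain X) (maxchain [set y in X | r x y]).+1.
Proof.
move=> sym xX; apply/eqP; rewrite eqn_leq geq_max maxchain_sub ?subsetUr //=.
apply/andP; split.
  apply: maxchain_leq => S sS cS; rewrite leq_max; case: (boolP (x \in S)) => xS; last first.
    apply/orP; left; apply: leq_maxchain => //; apply/subsetP => y yS.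
    by have := subsetP sS y yS; case/setU1P => // e; rewrite -e yS in xS.
  apply/orP; right; rewrite (cardsD1 x) xS add1n ltnS; apply: leq_maxchain.
    apply/subsetP => y; rewrite !inE => /andP[yx yS].
    have := subsetP sS y yS; rewrite !inE (negbTE yx) /= => -> /=.
    by apply: (chainP _ cS) => //; rewrite eq_sym.
  by apply: (chain_sub cS); rewrite subsetDl.
have [S [sS cS <-]] := maxchain_ex [set y in X | r x y].
have SP y : y \in S -> y \in X /\ r x y.
  by move=> /(subsetP sS); rewrite inE => /andP[].
have xS : x \notin S by apply: contra xX => /SP[].
have eS : #|x |: S| = #|S|.+1 by rewrite cardsU1 xS.
rewrite -eS; apply: leq_maxchain.
  by apply/subsetP => y /setU1P[->|/SP[yX _]]; rewrite !inE ?eqxx ?yX ?orbT.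
by apply: chainU1 => // y /SP[yX rxy] //; rewrite -sym.
Qed.

Lemma maxchain_isolated x X : (forall y, y \in X -> r x y = r y x) -> x \notin X ->
  chain X -> (forall y, y \in X -> ~~ r x y) -> maxchain (x |: X) = maxn 1 #|X|.
Proof.
move=> sym xX cX iso; rewrite maxchainU1_sym // maxchain_full // maxnC.
rewrite (_ : [set y in X | r x y] = set0) ?maxchain0 //.
by apply/setP => y; rewrite !inE; apply/negP => /andP[/iso/negP].
Qed.

(** When [X] is a set of points in the plane and insertion attaches to it a shape with at most two
rows, this is the difference of the row lengths, by Schensted's theorem. *)
Definition defect X : int := ((maxchain X).*2)%:Z - #|X|%:Z.

Lemma defect_range X : #|X| <= (maxchain X).*2 -> (0 <= defect X <= #|X|%:Z)%R.
Proof. by have := maxchain_card X; rewrite /defect; clear; lia. Qed.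

Lemma defectU1 x X : x \notin X -> (`|defect (x |: X) - defect X|%R = 1).
Proof.
move=> xX; have := maxchainU1 x X; have := maxchain_sub (subsetUr [set x] X).
by rewrite /defect cardsU1 xX; clear; lia.
Qed.

Lemma defect0 : defect set0 = 0%R.
Proof. by rewrite /defect maxchain0 cards0. Qed.

End Chains.

(** * Longest chains of points in the plane *)

(** The elements of [X] are points of the plane in general position, and [r] is comparability
for the product order. Incomparability then comes from an order as well: every argument below
plays these two orders against each other. *)
Definition planar (T : finType) (r : rel T) (pos val : T -> nat) (X : {set T}) :=
  forall x y, x \in X -> y \in X -> x != y ->
  [/\ pos x != pos y, val x != val y & r x y = ((pos x < pos y) == (val x < val y))].

Lemma planarC (T : finType) (r : rel T) pos val (X : {set T}) :
  planar r pos val X -> planar r val pos X.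
Proof. by move=> h x y xX yX ne; have [? ? ->] := h x y xX yX ne; split=> //; rewrite eq_sym. Qed.

Section Planar.

Variables (T : finType) (r : rel T) (pos val : T -> nat) (X : {set T}).
Hypothesis plX : planar r pos val X.
Implicit Types (S W : {set T}) (x y p q : T).

Variant planar_spec x y : bool -> Prop :=
| PlanarUp of pos x < pos y & val x < val y : planar_spec x y true
| PlanarDown of pos y < pos x & val y < val x : planar_spec x y true
| PlanarLeft of pos x < pos y & val y < val x : planar_spec x y false
| PlanarRight of pos y < pos x & val x < val y : planar_spec x y false.

Lemma planarP x y : x \in X -> y \in X -> x != y -> planar_spec x y (r x y).
Proof.
move=> xX yX /(plX xX yX)[]; case: (ltngtP (pos x) (pos y)) => // h1 _;
  case: (ltngtP (val x) (val y)) => // h2 _ ->; by constructor.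
Qed.

Lemma planar_sym x y : x \in X -> y \in X -> r x y = r y x.
Proof.
move=> xX yX; case: (eqVneq x y) => [->//|ne].
have ne' : y != x by rewrite eq_sym.
by case: (planarP xX yX ne) => h1 h2; case: (planarP yX xX ne') => // h3 h4; lia.
Qed.

Lemma cardsU_cover (A B s t : {set T}) : s :|: t \subset A :|: B ->
  s :&: t \subset A :&: B -> #|s| + #|t| <= #|A| + #|B|.
Proof.
by move=> /subset_leq_card h1 /subset_leq_card h2; rewrite -(cardsUI s t) -(cardsUI A B) leq_add.
Qed.

(** Two chains can be replaced by their upper left and lower right envelopes: incomparability,
oriented by [pos], is an order, and [H] and [G] consist of its minimal and maximal elements in
the union. Nothing is lost, since an element of one chain that is neither minimal nor maximal
would lie between two elements of the other chain, which would then be incomparable. *)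
Lemma exchange (s t : {set T}) : s \subset X -> t \subset X -> chain r s -> chain r t ->
  exists H G : {set T},
  [/\ chain r H, chain r G, #|s| + #|t| <= #|H| + #|G|,
      H \subset s :|: t /\
      (forall x y, x \in H -> y \in s :|: t -> pos y < pos x -> val y <= val x) &
      G \subset s :|: t /\
      (forall x y, x \in G -> y \in s :|: t -> pos x < pos y -> val x <= val y)].
Proof.
move=> sX tX cs ct.
pose cr x y := (pos x < pos y) && (val y < val x).
pose H := [set x in s :|: t | [forall y in s :|: t, ~~ cr y x]].
pose G := [set x in s :|: t | [forall y in s :|: t, ~~ cr x y]].
have uX : s :|: t \subset X by rewrite subUset sX tX.
have uXP x : x \in s :|: t -> x \in X by apply: (subsetP uX).
have ncr S x y : S \subset X -> chain r S -> x \in S -> y \in S -> cr x y = false.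
  move=> SX /chainP cS xS yS; case: (eqVneq x y) => [->|ne]; first by rewrite /cr ltnn.
  have := cS x y xS yS ne; rewrite /cr.
  by case: (planarP (subsetP SX _ xS) (subsetP SX _ yS) ne) => // h1 h2 _; clear -h1 h2; lia.
have chA (A : {set T}) : A \subset s :|: t ->
    (forall x y, x \in A -> y \in A -> cr x y = false) -> chain r A.
  move=> As nA; apply/chainP => x y xA yA ne.
  have xX := uXP _ (subsetP As _ xA); have yX := uXP _ (subsetP As _ yA).
  have := nA x y xA yA; have := nA y x yA xA; rewrite /cr.
  by case: (planarP xX yX ne) => // h1 h2; rewrite h1 h2.
have HsubP : H \subset s :|: t by apply/subsetP => x; rewrite inE => /andP[].
have GsubP : G \subset s :|: t by apply/subsetP => x; rewrite inE => /andP[].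
have HP x y : x \in H -> y \in s :|: t -> cr y x = false.
  by rewrite inE => /andP[_ /forall_inP h] /h /negbTE.
have GP x y : x \in G -> y \in s :|: t -> cr x y = false.
  by rewrite inE => /andP[_ /forall_inP h] /h /negbTE.
exists H, G; split.
- by apply: chA => // x y xH yH; apply: HP => //; apply: (subsetP HsubP).
- by apply: chA => // x y xH yH; apply: GP => //; apply: (subsetP GsubP).
- apply: cardsU_cover; apply/subsetP => x.
  + move=> xst; rewrite inE; apply/orP.
    case: (boolP (x \in H)) => xH; [by left | right]; rewrite inE xst /=.
    move: xH; rewrite inE xst /= negb_forall => /existsP[y].
    rewrite negb_imply negbK => /andP[yst cyx].
    apply/forall_inP => z zst; apply/negP => cxz.
    have cyz : cr y z by move: cyx cxz; rewrite /cr; clear; lia.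
    move: xst yst zst; rewrite !inE => /orP[xs|xt] /orP[ys|yt] /orP[zs|zt];
      do 1?[by rewrite (ncr s y x) in cyx]; do 1?[by rewrite (ncr t y x) in cyx];
      do 1?[by rewrite (ncr s x z) in cxz]; do 1?[by rewrite (ncr t x z) in cxz];
      do 1?[by rewrite (ncr s y z) in cyz]; by rewrite (ncr t y z) in cyz.
  + rewrite 5!inE => /andP[xs xt]; rewrite !inE xs xt /=.
    apply/andP; split; apply/forall_inP => y; rewrite inE => /orP[ys|yt].
    * by rewrite (ncr s y x).
    * by rewrite (ncr t y x).
    * by rewrite (ncr s x y).
    * by rewrite (ncr t x y).
- split=> // x y xH yst; have := HP x y xH yst.
  by rewrite /cr (leqNgt (val y)) => + lt; rewrite lt => /= ->.
- split=> // x y xH yst; have := GP x y xH yst.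
  by rewrite /cr (leqNgt (val x)) => + lt; rewrite lt => /= ->.
Qed.

(** Two chains through a common element can exchange their tails. The total size does not change,
so that longest chains give longest chains. *)
Lemma splice (s t : {set T}) z : s \subset X -> t \subset X -> chain r s -> chain r t ->
  z \in s -> z \in t ->
  let s' := [set y in s | pos y <= pos z] :|: [set y in t | pos z < pos y] in
  let t' := [set y in t | pos y <= pos z] :|: [set y in s | pos z < pos y] in
  [/\ chain r s', chain r t', #|s'| + #|t'| = #|s| + #|t|,
   forall y, y \in s' -> (y \in s /\ val y <= val z) \/ (y \in t /\ val z < val y) &
   forall y, y \in t' -> (y \in t /\ val y <= val z) \/ (y \in s /\ val z < val y)].
Proof.
have val_z S y : S \subset X -> chain r S -> z \in S -> y \in S ->
    (val y <= val z) = (pos y <= pos z).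
  move=> SX /chainP cS zS yS; case: (eqVneq y z) => [->|ne]; first by rewrite !leqnn.
  have := cS y z yS zS ne.
  case: (planarP (subsetP SX _ yS) (subsetP SX _ zS) ne) => // h1 h2 _;
    by clear -h1 h2; lia.
have gen (s1 t1 : {set T}) : s1 \subset X -> t1 \subset X -> chain r s1 -> chain r t1 ->
    z \in s1 -> z \in t1 ->
    let u := [set y in s1 | pos y <= pos z] :|: [set y in t1 | pos z < pos y] in
    [/\ chain r u, #|u| = #|[set y in s1 | pos y <= pos z]| + #|[set y in t1 | pos z < pos y]| &
     forall y, y \in u -> (y \in s1 /\ val y <= val z) \/ (y \in t1 /\ val z < val y)].
  move=> sX tX cs ct zs zt u; have vs := val_z _ _ sX cs zs; have vt := val_z _ _ tX ct zt.
  have uP y : y \in u -> (y \in s1 /\ val y <= val z) \/ (y \in t1 /\ val z < val y).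
    rewrite !inE => /orP[] /andP[y1 y2]; [left|right]; split=> //; first by rewrite vs.
    by rewrite ltnNge vt // -ltnNge.
  split=> //.
    apply/chainP => x y xu yu ne.
    have xX : x \in X.
      by case: (uP x xu) => [[/(subsetP sX)]|[/(subsetP tX)]].
    have yX : y \in X.
      by case: (uP y yu) => [[/(subsetP sX)]|[/(subsetP tX)]].
    case: (uP x xu) (uP y yu) => [[x1 x2]|[x1 x2]] [[y1 y2]|[y1 y2]].
    - exact: (chainP _ _ cs).
    - have := vs x x1; have := vt y y1.
      by case: (planarP xX yX ne) => // h1 h2; move: x2 y2; clear -h1 h2; lia.
    - have := vt x x1; have := vs y y1.
      by case: (planarP xX yX ne) => // h1 h2; move: x2 y2; clear -h1 h2; lia.
    - exact: (chainP _ _ ct).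
  rewrite cardsU (_ : _ :&: _ = set0) ?cards0 ?subn0 //.
  by apply/setP => y; rewrite !inE ltnNge; case: leqP; rewrite ?andbF.
move=> sX tX cs ct zs zt s' t'.
have [c1 e1 u1] := gen s t sX tX cs ct zs zt.
have [c2 e2 u2] := gen t s tX sX ct cs zt zs.
split=> //; rewrite /s' /t' e1 e2.
have split_card (A : {set T}) :
    #|[set y in A | pos y <= pos z]| + #|[set y in A | pos z < pos y]| = #|A|.
  rewrite -(cardsID [set y | pos y <= pos z] A); congr (_ + _); apply: eq_card => y;
    by rewrite !inE // -ltnNge andbC.
by have := split_card s; have := split_card t; lia.
Qed.

(** Without three pairwise incomparable elements, the elements that are incomparable to nothing
on their upper left form a chain, and so do the others: hence two chains cover [W]. *)
Lemma card_maxchain2 :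
  (forall x y z, x \in X -> y \in X -> z \in X -> pos x < pos y -> pos y < pos z ->
     val y < val x -> val z < val y -> False) ->
  forall W, W \subset X -> #|W| <= (maxchain r W).*2.
Proof.
move=> no3 W WX.
pose A := [set x in W | [forall y in W, (pos y < pos x) ==> (val y < val x)]].
have AW : A \subset W by apply/subsetP => x; rewrite inE => /andP[].
have AP x y : x \in A -> y \in W -> pos y < pos x -> val y < val x.
  by rewrite inE => /andP[_ /forall_inP h] /h /implyP.
have cA : chain r A.
  apply/chainP => x y xA yA ne; have xW := subsetP AW _ xA; have yW := subsetP AW _ yA.
  have := AP x y xA yW; have := AP y x yA xW.
  by case: (planarP (subsetP WX _ xW) (subsetP WX _ yW) ne) => // h1 h2; clear -h1 h2; lia.
have BP x : x \in W :\: A -> exists2 y, y \in W & (pos y < pos x) && (val x <= val y).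
  rewrite !inE => /andP[xA xW]; move: xA; rewrite xW negb_forall => /existsP[y].
  by rewrite !negb_imply -leqNgt => /and3P[yW h1 h2]; exists y; rewrite ?h1.
have cB : chain r (W :\: A).
  apply/chainP => x y xB yB ne.
  have xW : x \in W by move: xB; rewrite inE => /andP[].
  have yW : y \in W by move: yB; rewrite inE => /andP[].
  have xX := subsetP WX _ xW; have yX := subsetP WX _ yW.
  have [x' x'W /andP[hx1 hx2]] := BP x xB; have [y' y'W /andP[hy1 hy2]] := BP y yB.
  have x'X := subsetP WX _ x'W; have y'X := subsetP WX _ y'W.
  have nex : x' != x by apply/eqP => e; rewrite e ltnn in hx1.
  have ney : y' != y by apply/eqP => e; rewrite e ltnn in hy1.
  have [_ vx' _] := plX x'X xX nex; have [_ vy' _] := plX y'X yX ney.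
  have := no3 x' x y x'X xX yX hx1; have := no3 y' y x y'X yX xX hy1.
  case: (planarP xX yX ne) => // h1 h2; move: hx2 hy2 vx' vy'; clear -h1 h2.
    by move=> hx2 _ vx' _ _ h; exfalso; apply: h => //; lia.
  by move=> _ hy2 _ vy' h _; exfalso; apply: h => //; lia.
have := leq_maxchain AW cA; have := leq_maxchain (subsetDl W A) cB.
by have := cardsID A W; rewrite (setIidPr AW); lia.
Qed.

(** Two points [p] and [q] on the border of the bounding box are added to [W]. The map that sends
a set to the length of its longest chain is a growth function, and the next lemmas are its local
rules, written with [defect]. *)
Section Square.

Variables (W : {set T}) (p q : T).
Hypotheses (WX : W \subset X) (pX : p \in X) (qX : q \in X).
Hypotheses (pW : p \notin W) (qW : q \notin W) (pq : p != q).
Hypothesis half : forall V : {set T}, V \subset X -> #|V| <= (maxchain r V).*2.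

Let L := maxchain r W.
Let Lp := maxchain r (p |: W).
Let Lq := maxchain r (q |: W).
Let Lpq := maxchain r (p |: (q |: W)).

Lemma two_point_bounds :
  [/\ L <= Lp <= L.+1, L <= Lq <= L.+1, Lp <= Lpq <= Lp.+1 & Lq <= Lpq <= Lq.+1].
Proof.
have e : Lpq = maxchain r (q |: (p |: W)) by rewrite /Lpq setUCA.
split; apply/andP; split; rewrite ?maxchainU1 ?maxchain_sub ?subsetUr //.
- by rewrite /Lpq setUS ?subsetUr.
- by rewrite e maxchainU1.
Qed.

Lemma two_point_cards : [/\ #|p |: W| = #|W|.+1, #|q |: W| = #|W|.+1 &
  #|p |: (q |: W)| = #|W|.+2].
Proof. by rewrite !cardsU1 !inE negb_or pq pW qW. Qed.

Lemma two_point_half : [/\ #|W| <= L.*2, #|W|.+1 <= Lp.*2, #|W|.+1 <= Lq.*2 & #|W|.+2 <= Lpq.*2].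
Proof.
have [e1 e2 e3] := two_point_cards; split; [|rewrite -e1|rewrite -e2|rewrite -e3];
  by apply: half; rewrite ?subUset ?sub1set ?pX ?qX ?WX.
Qed.

Lemma planar_notin v x : v \in X -> v \notin W -> x \in W ->
  planar_spec v x (r v x).
Proof.
move=> vX vW xW; apply: planarP => //; first exact: (subsetP WX).
by apply: contraNneq vW => ->.
Qed.

Lemma raiseP (v : T) : v \in X -> v \notin W ->
  (exists S : {set T}, [/\ S \subset W, chain r S, #|S| = L & forall y, y \in S -> r v y]) ->
  L < maxchain r (v |: W).
Proof.
move=> vX vW [S [SW cS <- rS]].
have vS : v \notin S by apply: contra vW; exact: (subsetP SW).
have eS : #|v |: S| = #|S|.+1 by rewrite cardsU1 vS.
rewrite -eS; apply: leq_maxchain; first exact: setUS.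
apply: chainU1 => // y yS; rewrite planar_sym ?rS //.
by apply/(subsetP WX)/(subsetP SW).
Qed.

Lemma raise2P : r p q ->
  (exists S : {set T}, [/\ S \subset W, chain r S, #|S| = L &
     forall y, y \in S -> r p y && r q y]) -> L.+2 <= Lpq.
Proof.
move=> rpq [S [SW cS <- rS]].
have SX : S \subset X by apply: subset_trans WX.
have qS : q \notin S by apply: contra qW; exact: (subsetP SW).
have pS : p \notin S by apply: contra pW; exact: (subsetP SW).
have eS : #|p |: (q |: S)| = #|S|.+2 by rewrite !cardsU1 !inE negb_or pq qS pS.
rewrite -eS; apply: leq_maxchain; first by rewrite !setUS.
have cqS : chain r (q |: S).
  apply: chainU1 => // y yS; first by case/andP: (rS y yS).
  by rewrite planar_sym // ?(subsetP SX) //; case/andP: (rS y yS).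
apply: chainU1 => // y; case/setU1P => [->|yS]; rewrite ?rpq //.
- by case/andP: (rS y yS).
- by rewrite planar_sym.
by rewrite planar_sym // ?(subsetP SX) //; case/andP: (rS y yS).
Qed.

Lemma jointP : Lp = L -> Lq = L -> L < Lpq ->
  r p q /\ exists S : {set T}, [/\ S \subset W, chain r S, #|S|.+1 = L &
     forall y, y \in S -> r p y && r q y].
Proof.
move=> ep eq lt; have [S [sS cS eS]] := maxchain_ex r (p |: (q |: W)).
have pS : p \in S.
  apply: contraLR lt => pS; rewrite -leqNgt -eq /Lpq -eS; apply: leq_maxchain => //.
  apply/subsetP => x xS; have := subsetP sS _ xS; rewrite inE => /orP[] //.
  by rewrite inE => /eqP e; rewrite -e xS in pS.
have qS : q \in S.
  apply: contraLR lt => qS; rewrite -leqNgt -ep /Lpq -eS; apply: leq_maxchain => //.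
  apply/subsetP => x xS; have := subsetP sS _ xS; rewrite !inE => /or3P[-> //|/eqP e|->].
    by rewrite -e xS in qS.
  by rewrite orbT.
split; first exact: (chainP _ _ cS).
exists (S :\ p :\ q); split.
- by rewrite !subDset.
- by apply: (chain_sub cS); exact: subset_trans (subsetDl _ _) (subsetDl _ _).
- have := cardsD1 p S; have := cardsD1 q (S :\ p); rewrite pS !inE qS eq_sym pq /=.
  have := maxchainU1 r p (q |: W); rewrite -/Lpq -/Lq eq.
  by move: lt; have : #|S| = Lpq by []; clear; lia.
- move=> y; rewrite !inE => /and3P[yq yp yS]; have /chainP h := cS.
  by rewrite !h // eq_sym.
Qed.

(** The leftmost point [p] and the rightmost point [q]. The absolute value says that the two
increments of the longest chain add up, except when [W] splits into two longest chains. If [p]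
and [q] prolong longest chains [s] and [t], then either these are disjoint, hence fill half of
[W] each, or they can be spliced into one that [p] and [q] both prolong. If neither prolongs a
longest chain, the envelopes of a longest chain and of a chain one shorter that lies between [p]
and [q] show that they do not do so jointly. *)
Lemma square_opposite :
  (forall x, x \in W -> pos p < pos x < pos q) -> pos p < pos q ->
  defect r (q |: W) = `|defect r (p |: (q |: W)) + defect r W - defect r (p |: W)|%R /\
  defect r (p |: W) = `|defect r (p |: (q |: W)) + defect r W - defect r (q |: W)|%R.
Proof.
move=> hpos ppq; have [b1 b2 b3 b4] := two_point_bounds; have [h1 h2 h3 h4] := two_point_half.
have rp x : x \in W -> r p x = (val p < val x).
  by move=> /[dup] /hpos h xW; case: (planar_notin pX pW xW) => h5 h6; move: h; clear -h5 h6; lia.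
have rq x : x \in W -> r q x = (val x < val q).
  by move=> /[dup] /hpos h xW; case: (planar_notin qX qW xW) => h5 h6; move: h; clear -h5 h6; lia.
have rpq : r p q = (val p < val q).
  by case: (planarP pX qX pq) => h5 h6; move: ppq; clear -h5 h6; lia.
suff [hA hB] : (Lp = L.+1 -> Lq = L.+1 -> L.+2 <= Lpq \/ L.*2 <= #|W|) /\
               (Lp = L -> Lq = L -> Lpq <= L).
  have [e1 e2 e3] := two_point_cards; rewrite /defect e1 e2 e3 -/L -/Lp -/Lq -/Lpq.
  move: b1 b2 b3 b4 h1 h2 h3 h4 hA hB; clear; generalize L Lp Lq Lpq #|W|; lia.
split.
- move=> /maxchainU1_ex[s [sW cs es rs]] /maxchainU1_ex[t [tW ct et rt]].
  have sX := subset_trans sW WX; have tX := subset_trans tW WX.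
  case: (set_0Vmem (s :&: t)) => [st0|[z]].
    right; have := cardsUI s t; rewrite st0 cards0 es et -/L.
    have : #|s :|: t| <= #|W| by apply: subset_leq_card; rewrite subUset sW tW.
    by clear; lia.
  rewrite inE => /andP[zs zt]; left.
  have [c1 c2 e12 m1 m2] := splice sX tX cs ct zs zt.
  set s' := _ :|: _ in c1 e12 m1; set t' := _ :|: _ in c2 e12 m2.
  have s'W : s' \subset W.
    by apply/subsetP => y /m1[[/(subsetP sW)]|[/(subsetP tW)]].
  have t'W : t' \subset W.
    by apply/subsetP => y /m2[[/(subsetP tW)]|[/(subsetP sW)]].
  have l1 := leq_maxchain s'W c1; have l2 := leq_maxchain t'W c2.
  have zW := subsetP sW _ zs.
  have pz : val p < val z by rewrite -rp // rs.
  have zq : val z < val q by rewrite -rq // rt.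
  apply: raise2P; first by rewrite rpq; exact: ltn_trans zq.
  exists s'; split=> //; first by move: l1 l2 e12; rewrite es et -/L; clear; lia.
  move=> y ys'; have yW := subsetP s'W _ ys'.
  rewrite rp // rq //; case: (m1 y ys') => [[ys]|[yt]].
    by have := rs y ys; rewrite rp // => -> le; exact: leq_ltn_trans le zq.
  by have := rt y yt; rewrite rq // => -> le; rewrite (ltn_trans pz).
- move=> ep eq; rewrite leqNgt; apply/negP => lt.
  have [rpqT [c [cW cc ec rc]]] := jointP ep eq lt.
  have [m [mW cm em]] := maxchain_ex r W; rewrite -/L in em.
  have noP (S : {set T}) : S \subset W -> chain r S -> L <= #|S| ->
      (forall y, y \in S -> val p < val y) -> False.
    move=> SW cS eS hS; have leS := leq_maxchain SW cS.
    suff : L < Lp by rewrite ep ltnn.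
    apply: raiseP => //; exists S; split=> //; first by apply/eqP; rewrite eqn_leq leS.
    by move=> y yS; rewrite rp ?hS // (subsetP SW).
  have noQ (S : {set T}) : S \subset W -> chain r S -> L <= #|S| ->
      (forall y, y \in S -> val y < val q) -> False.
    move=> SW cS eS hS; have leS := leq_maxchain SW cS.
    suff : L < Lq by rewrite eq ltnn.
    apply: raiseP => //; exists S; split=> //; first by apply/eqP; rewrite eqn_leq leS.
    by move=> y yS; rewrite rq ?hS // (subsetP SW).
  have mX := subset_trans mW WX; have cX := subset_trans cW WX.
  have [H [G [cH cG eHG [HS Hmin] [GS Gmax]]]] := exchange mX cX cm cc.
  have uW : m :|: c \subset W by rewrite subUset mW.
  have cval y : y \in c -> val p < val y < val q.
    by move=> yc; have yW := subsetP cW _ yc; have := rc y yc; rewrite rp ?rq.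
  have add1 x : x \in W -> x \notin c -> (forall y, y \in c -> r x y) ->
      [/\ x |: c \subset W, chain r (x |: c) & L <= #|x |: c|].
    move=> xW xc rx; split; first by rewrite subUset sub1set xW.
      apply: chainU1 => // y yc; rewrite planar_sym ?rx //; last exact: (subsetP WX).
      exact: (subsetP cX).
    by rewrite cardsU1 xc /= -ec.
  have [lH|lG] : L <= #|H| \/ L <= #|G| by move: ec eHG; rewrite em; clear; lia.
  + apply: (noP H) => // [|x xH]; first exact: subset_trans uW.
    rewrite ltnNge; apply/negP => xp.
    have xst := subsetP HS _ xH; have xW := subsetP uW _ xst.
    have xc : x \notin c by apply/negP => /cval; move: xp; clear; lia.
    have [|a1 a2 a3] := add1 x xW xc.
      move=> y yc; have ne : x != y by apply: contraNneq xc => ->.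
      have := cval y yc; have : y \in m :|: c by rewrite inE yc orbT.
      move=> /(Hmin x y xH); move: xp.
      by case: (planarP (subsetP WX _ xW) (subsetP cX _ yc) ne) => // h5 h6; clear -h5 h6; lia.
    apply: (noQ (x |: c)) => // y /setU1P[->|/cval /andP[] //].
    by move: rpqT; rewrite rpq; exact: leq_ltn_trans.
  + apply: (noQ G) => // [|x xG]; first exact: subset_trans uW.
    rewrite ltnNge; apply/negP => xp.
    have xst := subsetP GS _ xG; have xW := subsetP uW _ xst.
    have xc : x \notin c by apply/negP => /cval; move: xp; clear; lia.
    have [|a1 a2 a3] := add1 x xW xc.
      move=> y yc; have ne : x != y by apply: contraNneq xc => ->.
      have := cval y yc; have : y \in m :|: c by rewrite inE yc orbT.
      move=> /(Gmax x y xG); move: xp.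
      by case: (planarP (subsetP WX _ xW) (subsetP cX _ yc) ne) => // h5 h6; clear -h5 h6; lia.
    apply: (noP (x |: c)) => // y /setU1P[->|/cval /andP[] //].
    by move: rpqT; rewrite rpq => lt1; exact: leq_trans xp.
Qed.

(** The leftmost point [p] and the topmost point [q], which are always comparable. If both prolong
a longest chain, then both prolong the upper left envelope of two such chains. If neither does
but both together prolong a chain [c], then [c] is disjoint from every longest chain, by splicing,
so that [W] has at most one element outside of two disjoint chains. *)
Lemma square_adjacent :
  (forall x, x \in W -> (pos p < pos x) && (val x < val q)) ->
  pos p < pos q -> val p < val q ->
  defect r W = `|defect r (p |: W) + defect r (q |: W) - defect r (p |: (q |: W))|%R /\
  defect r (p |: (q |: W)) = `|defect r (p |: W) + defect r (q |: W) - defect r W|%R.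
Proof.
move=> hpos ppq vpq; have [b1 b2 b3 b4] := two_point_bounds; have [h1 h2 h3 h4] := two_point_half.
have rp x : x \in W -> r p x = (val p < val x).
  by move=> /[dup] /hpos h xW; case: (planar_notin pX pW xW) => h5 h6; move: h; clear -h5 h6; lia.
have rq x : x \in W -> r q x = (pos x < pos q).
  by move=> /[dup] /hpos h xW; case: (planar_notin qX qW xW) => h5 h6; move: h; clear -h5 h6; lia.
have rpq : r p q.
  by case: (planarP pX qX pq) => // h5 h6; move: ppq vpq; clear -h5 h6; lia.
suff [hA hB] : (Lp = L.+1 -> Lq = L.+1 -> L.+2 <= Lpq) /\
               (Lp = L -> Lq = L -> Lpq <= L \/ L.*2 <= #|W|.+1).
  have [e1 e2 e3] := two_point_cards; rewrite /defect e1 e2 e3 -/L -/Lp -/Lq -/Lpq.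
  move: b1 b2 b3 b4 h1 h2 h3 h4 hA hB; clear; generalize L Lp Lq Lpq #|W|; lia.
split.
- move=> /maxchainU1_ex[s [sW cs es rs]] /maxchainU1_ex[t [tW ct et rt]].
  have sX := subset_trans sW WX; have tX := subset_trans tW WX.
  have [H [G [cH cG eHG [HS Hmin] [GS Gmax]]]] := exchange sX tX cs ct.
  have uW : s :|: t \subset W by rewrite subUset sW.
  have HW := subset_trans HS uW; have GW := subset_trans GS uW.
  have lH := leq_maxchain HW cH; have lG := leq_maxchain GW cG.
  have add1 (S : {set T}) x : S \subset W -> chain r S -> #|S| = L -> x \in W -> x \notin S ->
      (forall y, y \in S -> r x y) -> False.
    move=> SW cS eS xW xS rx; suff : #|x |: S| <= L by rewrite cardsU1 xS eS ltnn.
    apply: leq_maxchain; first by rewrite subUset sub1set xW.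
    apply: chainU1 => // y yc; rewrite planar_sym ?rx //; last exact: (subsetP WX).
    exact: (subsetP WX _ (subsetP SW _ yc)).
  apply: raise2P => //; exists H; split=> //; first by move: es et lH lG eHG; rewrite -/L; clear; lia.
  move=> x xH; have xst := subsetP HS _ xH; have xW := subsetP uW _ xst.
  rewrite rp // rq //; apply/andP; split; rewrite ltnNge; apply/negP => lex.
  + have sv y : y \in s -> val p < val y by move=> ys; rewrite -rp ?rs ?(subsetP sW).
    have xs : x \notin s by apply/negP => /sv; rewrite ltnNge lex.
    apply: (add1 s x) => // y ys.
    have ne : x != y by apply: contraNneq xs => ->.
    have := sv y ys; have : y \in s :|: t by rewrite inE ys.
    move=> /(Hmin x y xH); move: lex.
    by case: (planarP (subsetP WX _ xW) (subsetP sX _ ys) ne) => // h5 h6; clear -h5 h6; lia.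
  + have tv y : y \in t -> pos y < pos q by move=> yt; rewrite -rq ?rt ?(subsetP tW).
    have xt : x \notin t by apply/negP => /tv; rewrite ltnNge lex.
    apply: (add1 t x) => // y yt.
    have ne : x != y by apply: contraNneq xt => ->.
    have := tv y yt; have : y \in s :|: t by rewrite inE yt orbT.
    move=> /(Hmin x y xH); move: lex.
    by case: (planarP (subsetP WX _ xW) (subsetP tX _ yt) ne) => // h5 h6; clear -h5 h6; lia.
- move=> ep eq; case: (leqP Lpq L) => [|lt]; [by left | right].
  have [_ [c [cW cc ec rc]]] := jointP ep eq lt.
  have [m [mW cm em]] := maxchain_ex r W; rewrite -/L in em.
  have mX := subset_trans mW WX; have cX := subset_trans cW WX.
  case: (set_0Vmem (c :&: m)) => [st0|[z]].
    have := cardsUI c m; rewrite st0 cards0 em -ec.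
    have : #|c :|: m| <= #|W| by apply: subset_leq_card; rewrite subUset cW mW.
    by clear; lia.
  rewrite inE => /andP[zc zm]; exfalso.
  have [c1 c2 e12 m1 m2] := splice cX mX cc cm zc zm.
  set c' := _ :|: _ in c1 e12 m1; set m' := _ :|: _ in c2 e12 m2.
  have c'W : c' \subset W.
    by apply/subsetP => y /m1[[/(subsetP cW)]|[/(subsetP mW)]].
  have m'W : m' \subset W.
    by apply/subsetP => y /m2[[/(subsetP mW)]|[/(subsetP cW)]].
  have l1 := leq_maxchain c'W c1; have l2 := leq_maxchain m'W c2.
  have zW := subsetP cW _ zc.
  have pz : val p < val z by rewrite -rp //; case/andP: (rc z zc).
  have zq : pos z < pos q by rewrite -rq //; case/andP: (rc z zc).
  have nc' : #|c'| != L.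
    apply/eqP => e; suff : L < Lp by rewrite ep ltnn.
    apply: raiseP => //; exists c'; split=> // y yc'; have yW := subsetP c'W _ yc'.
    rewrite rp //; case: (m1 y yc') => [[yc _]|[ym]]; last exact: ltn_trans.
    by case/andP: (rc y yc); rewrite rp.
  have nm' : #|m'| != L.
    apply/eqP => e; suff : L < Lq by rewrite eq ltnn.
    apply: raiseP => //; exists m'; split=> // y ym'; have yW := subsetP m'W _ ym'.
    rewrite rq //; move: ym'; rewrite !inE => /orP[]/andP[h hp]; first exact: leq_ltn_trans zq.
    by case/andP: (rc y h) => _; rewrite rq.
  by move: l1 l2 nc' nm' e12; rewrite em -ec -/L -ec; clear; lia.
Qed.

End Square.

End Planar.

(** * Promotion of 2-fans in coordinates *)

Definition vec2 (a b : int) : 'rV[int]_2 := (\row_k (if k == ord0 then a else b))%R.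

Lemma dom_vec2 (x y a b : int) : (0 <= b <= a)%R ->
  (`|x| = a /\ `|y| = b)%R \/ (`|x| = b /\ `|y| = a)%R -> dom (vec2 x y) = vec2 a b.
Proof.
move=> ab h; apply/rowP => k; rewrite !mxE.
have -> : enum 'I_2 = [:: ord0; lift ord0 ord0].
  by apply: (inj_map val_inj); rewrite val_enum_ord.
rewrite /= !mxE /=.
have [hx|hx] := leqP `|y| `|x|; last first.
  have -> : sort geq [:: `|x|; `|y|] = [:: `|y|; `|x|].
    by rewrite /sort /= leqNgt hx.
  case: k => [[|[|//]] ik] /=; lia.
have -> : sort geq [:: `|x|; `|y|] = [:: `|x|; `|y|].
  by rewrite /sort /= hx.
case: k => [[|[|//]] ik] /=; lia.
Qed.

Lemma vec2_add a b c d e f : (vec2 a b + vec2 c d - vec2 e f = vec2 (a + c - e) (b + d - f))%R.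
Proof. by apply/rowP => k; rewrite !mxE; case: ifP. Qed.

Lemma absz_card (a b c d : nat) : a + d = b + c -> (`|b%:Z + c%:Z - a%:Z| = d%:Z)%R.
Proof. lia. Qed.

Lemma dom_isolated_arith (w : nat) :
  let u := ((maxn 1 w).*2%:Z - (true + w)%:Z)%R in
  dom (vec2 (w%:Z + w%:Z - (true + w)%:Z) ((w.*2%:Z - w%:Z) + (w.*2%:Z - w%:Z) - u))%R =
  vec2 (true + w)%:Z u.
Proof. by case: w => [|w] u; apply: dom_vec2; rewrite /u; [|left|lia|right; split]; lia. Qed.

(** The successive toggles write the values of [G] from left to right, each of them seeing the
new value on its left and the old ones at its place and on its right. *)
Lemma Pr_eq (m n : nat) (F G : fan m n) :
  (forall i, 0 < i < n.*2 -> mu G i = dom (mu G i.-1 + mu F i.+1 - mu F i)%R) ->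
  Pr F = G.
Proof.
move=> hG.
have mu0 (H : fan m n) : mu H 0 = 0%R by apply/rowP => k; rewrite !mxE height0.
have mul (H : fan m n) : mu H n.*2 = 0%R by apply/rowP => k; rewrite !mxE height_last.
have step k : k <= n.*2.-1 -> forall j, j <= n.*2 ->
    mu (foldl (fun G i => BK i G) F (iota 1 k)) j = if j <= k then mu G j else mu F j.
  elim: k => [|k IHk] lek j lej.
    by rewrite /= leqn0; case: eqP => // ->; rewrite !mu0.
  have klt : 0 < k.+1 < n.*2 by move: lek; clear; lia.
  have -> : iota 1 k.+1 = rcons (iota 1 k) k.+1 by rewrite -cats1 -{1}(addn1 k) iotaD add1n.
  rewrite foldl_rcons mu_BK //.
  have lek' : k <= n.*2.-1 by exact: ltnW.
  have [ej|nej] := eqVneq j k.+1.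
    rewrite ej leqnn !IHk ?(leqnn, ltnn, ltnS) //; try by move: klt; clear; lia.
    rewrite [RHS](hG _ klt) /=; case: (leqP k.+2 k) => // le.
    by exfalso; move: le; clear; lia.
  by rewrite IHk // [j <= k.+1]leq_eqVlt (negbTE nej).
apply: mu_inj => j lej; rewrite /Pr step //.
case: leqP => // lt; suff -> : j = n.*2 by rewrite !mul.
by move: lt lej; clear; lia.
Qed.

(** * Chord diagrams and the local rule *)

Section Chords.

Variable N : nat.
Notation chord := ('I_N * 'I_N)%type.
Implicit Types (e f g : chord) (E : {set chord}).

Definition noncrossing e f : bool :=
  ~~ [&& e.1 < f.1, f.1 < e.2 & e.2 < f.2] && ~~ [&& f.1 < e.1, e.1 < f.2 & f.2 < e.2].

Definition disjoint_chords e f := [&& e.1 != f.1, e.1 != f.2, e.2 != f.1 & e.2 != f.2].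

Record diagram E : Prop := Diagram {
  chord_lt : forall e : chord, e \in E -> e.1 < e.2;
  chord_cover : forall x, exists2 e : chord, e \in E & (x == e.1) || (x == e.2);
  chord_disjoint : forall e f : chord, e \in E -> f \in E -> e != f -> disjoint_chords e f;
  chord_no3 : forall e f g : chord, e \in E -> f \in E -> g \in E ->
    e.1 < f.1 -> f.1 < g.1 -> g.1 < e.2 -> e.2 < f.2 -> f.2 < g.2 -> False }.

Definition cut E j := [set e in E | e.1 < j <= e.2].

(** The chords with exactly one endpoint in {1, ..., j - 1}; rotation turns this interval into the
one that defines [cut] at [j - 1]. *)
Definition cut1 E j := [set e in E | if e.1 == 0 :> nat then e.2 < j else e.1 < j <= e.2].

(** The pair of heights of the two paths, (l1 + l2, l1 - l2) for a shape (l1, l2). *)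
Definition weight (S : {set chord}) := vec2 #|S|%:Z (defect noncrossing S).

Section Diagram.

Variables (E : {set chord}).
Hypothesis dE : diagram E.

Lemma disjoint_chordsP e f : e \in E -> f \in E -> e != f ->
  [/\ e.1 <> f.1 :> nat, e.1 <> f.2 :> nat, e.2 <> f.1 :> nat & e.2 <> f.2 :> nat].
Proof.
move=> eE fE ne; have /and4P[h1 h2 h3 h4] := chord_disjoint dE eE fE ne.
by split; apply/eqP.
Qed.

(** The four cuts of a local rule differ only by the side on which 0 and [j] lie, and one choice of
sides makes all chords of [square j] run from the left to the right of the cut. There, [pos] is
the endpoint on the left, and [val] increases while the endpoint on the right moves backwards,
so that nested chords are comparable. The exceptional case is a chord from 0 to a point before
[j]: then 0 is put on the right, after all other points, and gets the lowest value. *)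
Definition square_pos j e := if (e.1 == 0 :> nat) && (e.2 < j) then e.2 : nat else e.1.
Definition square_val j e := if (e.1 == 0 :> nat) && (e.2 < j) then 0 else N - e.2.

Definition square j := [set e in E | if e.1 == 0 :> nat then e.2 != j :> nat else e.1 <= j <= e.2].

Lemma square_planar j : planar noncrossing (square_pos j) (square_val j) (square j).
Proof.
move=> e f; rewrite !inE => /andP[eE he] /andP[fE hf] ne.
have [n1 n2 n3 n4] := disjoint_chordsP eE fE ne.
have le := chord_lt dE eE; have lf := chord_lt dE fE.
rewrite /square_pos /square_val /noncrossing.
have be := ltn_ord e.2; have bf := ltn_ord f.2.
case: e f {eE fE ne} le lf he hf be bf n1 n2 n3 n4 => [e1 e2] [f1 f2] /=.
move: (nat_of_ord e1) (nat_of_ord e2) (nat_of_ord f1) (nat_of_ord f2).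
clear; move=> e1 e2 f1 f2 le lf.
case: (posnP e1) => [->|pe]; case: (posnP f1) => [->|pf] //=.
- case: (ltnP e2 j) => h; rewrite /= => h1 h2 h3 h4 h5 h6 h7 h8; split; lia.
- case: (ltnP f2 j) => h; rewrite /= => h1 h2 h3 h4 h5 h6 h7 h8; split; lia.
- rewrite /= => h1 h2 h3 h4 h5 h6 h7 h8; split; lia.
Qed.

Lemma square_no3 j e f g : e \in square j -> f \in square j -> g \in square j ->
  square_pos j e < square_pos j f -> square_pos j f < square_pos j g ->
  square_val j f < square_val j e -> square_val j g < square_val j f -> False.
Proof.
rewrite !inE => /andP[eE he] /andP[fE hf] /andP[gE hg].
have le := chord_lt dE eE; have lf := chord_lt dE fE; have lg := chord_lt dE gE.
have n1 := chord_no3 dE eE fE gE; have n2 := chord_no3 dE gE eE fE.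
have n3 : e != g -> e.2 <> g.1 :> nat by move=> /(disjoint_chordsP eE gE)[].
have n5 : g.1 <> e.2 :> nat.
  have [eg|/n3 h] := eqVneq e g; last by move=> k; apply: h.
  by rewrite -eg => eq; move: le; rewrite eq ltnn.
have n4 : e.1 = g.1 :> nat -> e.2 = g.2 :> nat.
  by have [->//|/(disjoint_chordsP eE gE)[]] := eqVneq e g.
move: n5 n4 {n3}; rewrite /square_pos /square_val.
have be := ltn_ord e.2; have bf := ltn_ord f.2; have bg := ltn_ord g.2.
case: e f g {eE fE gE} le lf lg he hf hg be bf bg n1 n2 => [e1 e2] [f1 f2] [g1 g2] /=.
move: (nat_of_ord e1) (nat_of_ord e2) (nat_of_ord f1) (nat_of_ord f2)
  (nat_of_ord g1) (nat_of_ord g2).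
clear; move=> e1 e2 f1 f2 g1 g2 le lf lg.
case: (posnP e1) => [->|pe]; case: (posnP f1) => [->|pf]; case: (posnP g1) => [->|pg] //=;
  move=> h1 h2 h3 h4 h5 h6 n1 n2 n3 n4; do ?[case: ifP => ?];
  move=> k1 k2 k3 k4; do 1?[by apply: n1; lia]; do 1?[by apply: n2; lia]; lia.
Qed.

Lemma square_half j (V : {set chord}) :
  V \subset square j -> #|V| <= (maxchain noncrossing V).*2.
Proof. apply: card_maxchain2; [exact: square_planar | exact: square_no3]. Qed.

Lemma weight_range j (V : {set chord}) :
  V \subset square j -> (0 <= defect noncrossing V <= #|V|%:Z)%R.
Proof. by move=> /square_half; exact: defect_range. Qed.

(** The generic case: as the numbers of chords add up, [dom] only takes the absolute value of the
second coordinate. It applies when 0 and [j] are not partners. *)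
Lemma dom_weight j (A B C D : {set chord}) : D \subset square j ->
  #|A| + #|D| = #|B| + #|C| ->
  defect noncrossing D =
    `|defect noncrossing B + defect noncrossing C - defect noncrossing A|%R ->
  dom (weight B + weight C - weight A)%R = weight D.
Proof.
move=> /weight_range rD eN eh; rewrite /weight vec2_add; apply: dom_vec2 => //.
left; split=> //; exact: absz_card eN.
Qed.

(** The case where 0 and [j] are partners: their chord crosses all chords of [W], so these are
pairwise noncrossing, and [dom] exchanges the absolute values of the two coordinates. *)
Lemma dom_isolated (W : {set chord}) p : p \notin W -> chain noncrossing W ->
  (forall e, e \in W -> ~~ noncrossing p e) ->
  dom (weight W + weight W - weight (p |: W))%R = weight (p |: W).
Proof.
move=> pW cW iso; have sym e : e \in W -> noncrossing p e = noncrossing e p.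
  by move=> _; rewrite /noncrossing andbC.
rewrite /weight vec2_add /defect (maxchain_isolated sym pW cW iso).
rewrite (maxchain_full cW) cardsU1 pW; exact: dom_isolated_arith.
Qed.

(* Compares two sets of chords, given which chords are [p] and [q] and numeric facts. *)
Ltac cuts eqs facts :=
  let e := fresh "e" in let eE := fresh "eE" in
  apply/setP => e; rewrite !inE ?(eqs.1) ?(eqs.2);
  case: (boolP (e \in E)) => //= eE;
  do ?[case: ifP]; move: (chord_lt dE eE) (facts e eE); clear; lia.

(** The four cuts arise from the set [W] of the chords from {1, ..., j - 1} to what lies beyond
[j] by adding or not the chord [p] of the point 0 and the chord [q] of the point [j]. Which cut
gets which chord depends on the sides of the partners of 0 and [j]. *)
Lemma local_rule j : 0 < j < N ->
  dom (weight (cut E j.+1) + weight (cut1 E j) - weight (cut E j))%R = weight (cut1 E j.+1).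
Proof.
case/andP=> j0 jN; have N0 : 0 < N by exact: ltn_trans jN.
pose W := [set e in E | 0 < e.1 & e.1 < j < e.2].
have [p pE hp] : exists2 p : chord, p \in E &
    forall e : chord, (e == p) = (e \in E) && (e.1 == 0 :> nat).
  have [p pE hp] := chord_cover dE (Ordinal N0); exists p => //.
  have p1 : p.1 = 0 :> nat.
    move: hp (chord_lt dE pE) => /orP[]/eqP <- //=.
  move=> e; apply/eqP/andP => [->|[eE /eqP e1]]; first by rewrite p1.
  apply/eqP/negPn/negP => /(disjoint_chordsP eE pE)[]; by rewrite e1 p1.
have [q qE hq] : exists2 q : chord, q \in E &
    forall e : chord, (e == q) = (e \in E) && ((e.1 == j :> nat) || (e.2 == j :> nat)).
  have [q qE hq] := chord_cover dE (Ordinal jN); exists q => //.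
  have q1 : q.1 = j :> nat \/ q.2 = j :> nat by case/orP: hq => /eqP <-; [left|right].
  move=> e; apply/eqP/andP => [->|[eE e1]].
    by split=> //; apply/orP; case: q1 => ->; [left|right].
  apply/eqP/negPn/negP => /(disjoint_chordsP eE qE)[].
  by case: q1 => ->; case/orP: e1 => /eqP ->.
have pP e : e \in E -> e.1 = 0 :> nat -> e.2 = p.2 :> nat.
  by move=> eE e1; suff /eqP -> : e == p by []; rewrite hp eE e1 eqxx.
have qP e : e \in E -> (e.1 == j :> nat) || (e.2 == j :> nat) ->
    e.1 = q.1 :> nat /\ e.2 = q.2 :> nat.
  by move=> eE e1; suff /eqP -> : e == q by []; rewrite hq eE e1.
have p1 : p.1 = 0 :> nat by have := hp p; rewrite eqxx pE => /esym/eqP.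
have q1 : (q.1 == j :> nat) || (q.2 == j :> nat) by have := hq q; rewrite eqxx qE /= => <-.
have pW : p \notin W by rewrite inE p1 andbF.
have qW : q \notin W.
  by rewrite inE; case/orP: q1 => /eqP ->; rewrite ltnn !andbF.
have WX : W \subset square j.
  apply/subsetP => e; rewrite !inE => /and3P[-> + +].
  by move=> /[swap] /andP[h1 h2]; case: posnP => //= _ _; rewrite (ltnW h1) (ltnW h2).
have xW e : e \in W -> [/\ square_pos j e = e.1, square_val j e = N - e.2, 0 < e.1 < j,
    j < e.2 & e.2 < N].
  rewrite inE => /and4P[_ e0 e1 e2]; rewrite /square_pos /square_val e0 e1 e2 ltn_ord.
  by rewrite (gtn_eqF e0).
have [pq|pq] := eqVneq p q.
  have p2 : p.2 = j :> nat.
    by rewrite pq in p1 *; move: q1; rewrite p1 eq_sym (gtn_eqF j0) => /eqP.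
  have q0 : q.1 = 0 :> nat by rewrite -pq.
  have cross e : e \in W -> [&& p.1 < e.1, e.1 < p.2 & p.2 < e.2].
    by rewrite inE p1 p2 => /and3P[_ -> ->].
  have iso e : e \in W -> ~~ noncrossing p e.
    by move=> /cross h; rewrite /noncrossing h.
  have cW : chain noncrossing W.
    apply/chainP => e f eW fW ne; rewrite /noncrossing.
    have eE : e \in E by move: eW; rewrite inE => /andP[].
    have fE : f \in E by move: fW; rewrite inE => /andP[].
    move: (cross e eW) (cross f fW) => /and3P[e1 e2 e3] /and3P[f1 f2 f3].
    apply/andP; split; apply/negP => /and3P[h1 h2 h3].
      exact: (chord_no3 dE pE eE fE).
    exact: (chord_no3 dE pE fE eE).
  have facts e (eE : e \in E) := conj (pP e eE) (conj (qP e eE) (conj p2 (conj j0 q0))).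
  have -> : cut E j.+1 = W by cuts (hp, hq) facts.
  have -> : cut1 E j = W by cuts (hp, hq) facts.
  have -> : cut1 E j.+1 = p |: W by cuts (hp, hq) facts.
  have -> : cut E j = p |: W by cuts (hp, hq) facts.
  exact: dom_isolated.
have p2 : p.2 <> j :> nat.
  by have [_ _ h h'] := disjoint_chordsP pE qE pq; case/orP: q1 => /eqP <-.
have pX : p \in square j by rewrite inE pE p1; apply/eqP.
have plX := @square_planar j; have half := @square_half j.
have [cp cq cpq] := two_point_cards pW qW pq.
have q0 : 0 < q.1.
  by rewrite lt0n; apply: contraNneq pq => e; have := hp q; rewrite qE e eq_sym => ->.
have qX : q \in square j.
  rewrite inE qE (gtn_eqF q0) /=; have := chord_lt dE qE.
  move: q1; clear; lia.
have ppos : square_pos j p = if p.2 < j then p.2 : nat else 0.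
  by rewrite /square_pos p1.
have pval : square_val j p = if p.2 < j then 0 else N - p.2.
  by rewrite /square_val p1.
have qpos : square_pos j q = q.1 by rewrite /square_pos (gtn_eqF q0).
have qval : square_val j q = N - q.2 by rewrite /square_val (gtn_eqF q0).
have ltq := chord_lt dE qE; have ltqN := ltn_ord q.2; have ltpN := ltn_ord p.2.
have WqX : q |: W \subset square j by rewrite subUset sub1set qX.
have WpX : p |: W \subset square j by rewrite subUset sub1set pX.
have WpqX : p |: (q |: W) \subset square j by rewrite subUset sub1set pX.
have [pj|pj] := ltnP p.2 j; rewrite ?pj ?(leq_gtF pj) in ppos pval;
  case/orP: (q1) => /eqP q1';
  have facts e (eE : e \in E) := conj (pP e eE) (conj (qP e eE) (conj pj (conj q1'
    (conj j0 (conj q0 (conj p2 ltq)))))).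
(* Both partners are after j, or both before, when p and q lie on opposite sides of the box.
When the partner of 0 is before j, pos and val exchange their roles. *)
- have -> : cut E j = W by cuts (hp, hq) facts.
  have -> : cut E j.+1 = q |: W by cuts (hp, hq) facts.
  have -> : cut1 E j = p |: W by cuts (hp, hq) facts.
  have -> : cut1 E j.+1 = p |: (q |: W) by cuts (hp, hq) facts.
  apply: (@dom_weight j) => //; first by rewrite cp cq cpq !(addnS, addSn).
  have [| | |_ ->] := square_adjacent (planarC plX) WX pX qX pW qW pq half.
  + move=> x /xW[-> -> x1 x2 x3]; rewrite pval qpos.
    by move: x1 x2 x3 q1'; clear; lia.
  + by rewrite pval qval; move: ltqN; clear; lia.
  + by rewrite ppos qpos; move: pj q1'; clear; lia.
  by rewrite [(defect _ (p |: W) + _)%R]addrC.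
- have -> : cut E j = q |: W by cuts (hp, hq) facts.
  have -> : cut E j.+1 = W by cuts (hp, hq) facts.
  have -> : cut1 E j = p |: (q |: W) by cuts (hp, hq) facts.
  have -> : cut1 E j.+1 = p |: W by cuts (hp, hq) facts.
  apply: (@dom_weight j) => //; first by rewrite cp cq cpq !(addnS, addSn) addnC.
  have [| |_ ->] := square_opposite (planarC plX) WX pX qX pW qW pq half.
  + move=> x /xW[_ -> x1 x2 x3]; rewrite pval qval.
    by move: x1 x2 x3 q1'; clear; lia.
  + by rewrite pval qval; move: ltqN; clear; lia.
  by rewrite [(defect _ W + _)%R]addrC.
- have -> : cut E j = p |: W by cuts (hp, hq) facts.
  have -> : cut E j.+1 = p |: (q |: W) by cuts (hp, hq) facts.
  have -> : cut1 E j = W by cuts (hp, hq) facts.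
  have -> : cut1 E j.+1 = q |: W by cuts (hp, hq) facts.
  apply: (@dom_weight j) => //; first by rewrite cp cq cpq !(addnS, addSn) addnC.
  have [| |-> _ //] := square_opposite plX WX pX qX pW qW pq half.
  + move=> x /xW[-> _ x1 x2 x3]; rewrite ppos qpos.
    by move: x1 x2 x3 q1'; clear; lia.
  + by rewrite ppos qpos.
- have -> : cut E j = p |: (q |: W) by cuts (hp, hq) facts.
  have -> : cut E j.+1 = p |: W by cuts (hp, hq) facts.
  have -> : cut1 E j = q |: W by cuts (hp, hq) facts.
  have -> : cut1 E j.+1 = W by cuts (hp, hq) facts.
  apply: (@dom_weight j) => //; first by rewrite cp cq cpq !(addnS, addSn) addnC.
  have [| | |-> _ //] := square_adjacent plX WX pX qX pW qW pq half.
  + move=> x /xW[-> -> x1 x2 x3]; rewrite ppos qval.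
    by move: x1 x2 x3 q1'; clear; lia.
  + by rewrite ppos qpos.
  + by rewrite pval qval; move: p2 pj q1' ltpN; clear; lia.
Qed.

End Diagram.
End Chords.

(** * Rotation of chord diagrams *)

Lemma maxchain_imset (T T' : finType) (r : rel T) (r' : rel T') (f : T -> T') (X : {set T}) :
  {in X &, injective f} ->
  (forall x y, x \in X -> y \in X -> x != y -> r' (f x) (f y) = r x y) ->
  maxchain r' (f @: X) = maxchain r X.
Proof.
move=> injf rf; apply/eqP; rewrite eqn_leq; apply/andP; split.
  apply: maxchain_leq => S' S'X cS'.
  pose S := [set x in X | f x \in S'].
  have SX : S \subset X by apply/subsetP => x; rewrite inE => /andP[].
  have eS : f @: S = S'.
    apply/setP => y; apply/imsetP/idP => [[x]|yS].
      by rewrite inE => /andP[_ fx] ->.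
    have /imsetP[x xX e] := subsetP S'X y yS.
    by exists x => //; rewrite inE xX -e.
  rewrite -eS card_in_imset; last by move=> x y /(subsetP SX) xX /(subsetP SX) yX; exact: injf.
  apply: leq_maxchain => //; apply/chainP => x y xS yS ne.
  have xX := subsetP SX x xS; have yX := subsetP SX y yS.
  rewrite -rf //; move: xS yS; rewrite !inE => /andP[_ h1] /andP[_ h2].
  apply: (chainP _ _ cS') => //; apply: contra_neq ne; exact: injf.
apply: maxchain_leq => S SX cS.
have injS : {in S &, injective f}.
  by move=> x y /(subsetP SX) xX /(subsetP SX) yX; exact: injf.
rewrite -(card_in_imset injS); apply: leq_maxchain; first exact: imsetS.
apply/chainP => _ _ /imsetP[x xS ->] /imsetP[y yS ->] ne.
have ne' : x != y by apply: contra_neq ne => ->.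
rewrite rf ?(subsetP SX) //; exact: (chainP _ _ cS).
Qed.

Lemma val_ord_pred (N : nat) (x : 'I_N) : ord_pred x = (if x == 0 :> nat then N.-1 else x.-1) :> nat.
Proof.
have xN := ltn_ord x; rewrite /=; case: eqP => [->|/eqP x0].
  by rewrite add0n modn_small //; move: xN; clear; lia.
have -> : (x + N).-1 = x.-1 + N by move: x0; clear; lia.
by rewrite modnDr modn_small //; move: xN; clear; lia.
Qed.

Section Rotation.

Variable N : nat.
Notation chord := ('I_N * 'I_N)%type.
Implicit Types (e f : chord) (E : {set chord}).

Definition rot_chord (e : chord) : chord :=
  if e.1 == 0 :> nat then (ord_pred e.2, ord_pred e.1) else (ord_pred e.1, ord_pred e.2).

Lemma rot_chordE e : e.1 < e.2 ->
  (rot_chord e).1 = (if e.1 == 0 :> nat then e.2.-1 else e.1.-1) :> nat /\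
  (rot_chord e).2 = (if e.1 == 0 :> nat then N.-1 else e.2.-1) :> nat.
Proof.
move=> lt; have e2 : (e.2 == 0 :> nat) = false by move: lt; clear; case: (nat_of_ord e.2).
by rewrite /rot_chord; case: ifP => h; rewrite !val_ord_pred ?h e2.
Qed.

Variable E : {set chord}.
Hypothesis dE : diagram E.

Lemma rot_chord_inj : {in E &, injective rot_chord}.
Proof.
move=> e f eE fE eq; apply/eqP/negPn/negP => /(disjoint_chordsP dE eE fE)[h1 h2 h3 h4].
have [e1 e2] := rot_chordE (chord_lt dE eE); have [f1 f2] := rot_chordE (chord_lt dE fE).
have le := chord_lt dE eE; have lf := chord_lt dE fE.
have eN := ltn_ord e.2; have fN := ltn_ord f.2.
rewrite eq f1 in e1; rewrite eq f2 in e2; move: h1 h2 h3 h4 e1 e2 le lf eN fN; clear.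
by case: ifP => h1; case: ifP => h2; move: h1 h2; lia.
Qed.

Lemma noncrossing_rot e f : e \in E -> f \in E -> e != f ->
  noncrossing (rot_chord e) (rot_chord f) = noncrossing e f.
Proof.
move=> eE fE /(disjoint_chordsP dE eE fE)[h1 h2 h3 h4].
have le := chord_lt dE eE; have lf := chord_lt dE fE.
have [e1 e2] := rot_chordE le; have [f1 f2] := rot_chordE lf.
have eN := ltn_ord e.2; have fN := ltn_ord f.2.
rewrite /noncrossing e1 e2 f1 f2; move: h1 h2 h3 h4 le lf eN fN; clear.
by case: ifP => h1; case: ifP => h2; move: h1 h2; lia.
Qed.

(** The chord of 0 changes sides because its endpoint 0 becomes the last point. *)
Lemma cut_rot j : 0 < j <= N -> cut (rot_chord @: E) j.-1 = rot_chord @: cut1 E j.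
Proof.
case/andP=> j0 jN.
have main (e : chord) : e \in E -> ((rot_chord e).1 < j.-1 <= (rot_chord e).2) =
    (if e.1 == 0 :> nat then e.2 < j else e.1 < j <= e.2).
  move=> eE; have le := chord_lt dE eE; have [-> ->] := rot_chordE le.
  by have eN := ltn_ord e.2; move: j0 jN eN le; clear; case: ifP; lia.
apply/setP => x; rewrite inE; apply/andP/imsetP => [[/imsetP[e eE ->]]|[e]].
  by rewrite main // => h; exists e; rewrite // inE eE.
by rewrite inE => /andP[eE h] ->; rewrite main // imset_f.
Qed.

Lemma weight_cut_rot j : 0 < j <= N ->
  weight (cut (rot_chord @: E) j.-1) = weight (cut1 E j).
Proof.
move=> hj; have sub (e : chord) : e \in cut1 E j -> e \in E by rewrite inE => /andP[].
have inj : {in cut1 E j &, injective rot_chord}.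
  by move=> e f /sub eE /sub fE; exact: rot_chord_inj.
rewrite /weight /defect cut_rot // card_in_imset // (@maxchain_imset _ _ (@noncrossing N)) //.
by move=> e f /sub eE /sub fE; exact: noncrossing_rot.
Qed.

End Rotation.

(** * Matchings as chord diagrams *)

Section Matchings.

Variable n : nat.
Notation chord := ('I_n.*2 * 'I_n.*2)%type.
Implicit Types (e f : chord) (E : {set chord}) (M : {set {set 'I_n.*2}}).

Definition chords M : {set chord} := [set e : chord | (e.1 < e.2) && ([set e.1; e.2] \in M)].

Lemma block_eq M (A B : {set 'I_n.*2}) x :
  perfect_matching M -> A \in M -> B \in M -> x \in A -> x \in B -> A = B.
Proof.
move=> /andP[/and3P[_ triv _] _] AM BM xA xB; apply/eqP; apply: contraTT isT => ne.
have /disjointFr/(_ xA) := trivIsetP triv A B AM BM ne.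
by rewrite xB.
Qed.

Lemma set2_ord e f : e.1 < e.2 -> f.1 < f.2 -> [set e.1; e.2] = [set f.1; f.2] -> e = f.
Proof.
move=> le lf eq.
have : e.1 \in [set f.1; f.2] by rewrite -eq set21.
have : e.2 \in [set f.1; f.2] by rewrite -eq set22.
rewrite [e]surjective_pairing [f]surjective_pairing /= !inE.
case/orP => /eqP h2 /orP[]/eqP h1; rewrite h1 h2 // in le lf *; move: le lf; clear; lia.
Qed.

Lemma chords_diagram M : perfect_matching M -> ~~ crossing3 M -> diagram (chords M).
Proof.
move=> pM ncM; have /andP[/and3P[/eqP cov _ _] /forall_inP M2] := pM; split.
- by move=> e; rewrite inE => /andP[].
- move=> x; have : x \in [set: 'I_n.*2] by rewrite in_setT.
  rewrite -cov => /bigcupP[B BM xB].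
  have /cards2P[a [b [ab eB]]] := M2 B BM; rewrite eB in BM xB.
  case: (ltngtP a b) => [lt|lt|/val_inj eab].
  + by exists (a, b); [rewrite inE lt | move: xB; rewrite !inE].
  + exists (b, a); first by rewrite inE lt setUC.
    by move: xB; rewrite !inE orbC.
  + by rewrite eab eqxx in ab.
- move=> e f; rewrite !inE => /andP[le eM] /andP[lf fM] ne.
  apply/and4P; split; apply: contra_neq ne => eq; apply: set2_ord => //.
  + by apply: (block_eq pM eM fM (x := e.1)); rewrite ?set21 // eq set21.
  + by apply: (block_eq pM eM fM (x := e.1)); rewrite ?set21 // eq set22.
  + by apply: (block_eq pM eM fM (x := e.2)); rewrite ?set22 // eq set21.
  + by apply: (block_eq pM eM fM (x := e.2)); rewrite ?set22 // eq set22.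
- move=> e f g; rewrite !inE => /andP[_ eM] /andP[_ fM] /andP[_ gM] h1 h2 h3 h4 h5.
  case/negP: ncM; apply/existsP; exists e.1; apply/existsP; exists f.1.
  apply/existsP; exists g.1; apply/existsP; exists e.2; apply/existsP; exists f.2.
  by apply/existsP; exists g.2; rewrite eM fM gM h1 h2 h3 h4 h5.
Qed.

Lemma mem_rot_set M (x y : 'I_n.*2) :
  ([set x; y] \in rot_set M) = ([set ordS x; ordS y] \in M).
Proof.
have injS : injective (fun B : {set 'I_n.*2} => @ord_pred _ @: B).
  by apply: imset_inj; exact: ord_pred_inj.
have e : [set x; y] = @ord_pred _ @: [set ordS x; ordS y].
  by rewrite imsetU1 imset_set1 !ordSK.
apply/imsetP/idP => [[B BM]|h]; last by exists [set ordS x; ordS y].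
by rewrite e => /injS ->.
Qed.

Lemma chords_rot M : perfect_matching M -> chords (rot_set M) = @rot_chord n.*2 @: chords M.
Proof.
move=> pM; apply/setP => e; rewrite inE mem_rot_set.
apply/andP/imsetP => [[lt eM]|[f]].
  have [last|nlast] := eqVneq (e.2.+1) n.*2.
    exists (ordS e.2, ordS e.1).
      rewrite inE setUC eM /= last modnn andbT modn_small //.
      by apply: leq_ltn_trans lt _; exact: ltn_ord.
    have z : (ordS e.2, ordS e.1).1 == 0 :> nat by rewrite /= last modnn.
    by rewrite /rot_chord z !ordSK; case: (e).
  have lt2 : e.2.+1 < n.*2 by rewrite ltn_neqAle nlast ltn_ord.
  have lt1 : e.1.+1 < n.*2 by apply: ltn_trans lt2; rewrite ltnS.
  exists (ordS e.1, ordS e.2).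
    by rewrite inE eM /= !modn_small // ltnS lt.
  have z : ((ordS e.1, ordS e.2).1 == 0 :> nat) = false by rewrite /= modn_small.
  by rewrite /rot_chord z !ordSK; case: (e).
rewrite inE => /andP[lt fM] ->; have [h1 h2] := rot_chordE lt; split.
  rewrite h1 h2; have fN := ltn_ord f.2; move: lt fN; clear; case: f => a b /=; case: ifP; lia.
by rewrite /rot_chord; case: ifP => _ /=; rewrite !ord_predK // setUC.
Qed.

Definition blocks E : {set {set 'I_n.*2}} := [set [set e.1; e.2] | e : chord in E].

Lemma blocksK E : diagram E -> chords (blocks E) = E.
Proof.
move=> dE; apply/setP => e; rewrite inE; apply/andP/idP => [[lt /imsetP[f fE eq]]|eE].
  by rewrite (set2_ord lt (chord_lt dE fE) eq).
by split; [exact: chord_lt dE e eE | apply/imsetP; exists e].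
Qed.

Lemma blocks_matching E : diagram E -> perfect_matching (blocks E) && ~~ crossing3 (blocks E).
Proof.
move=> dE; apply/andP; split; last first.
  apply/negP => /existsP[i1 /existsP[i2 /existsP[i3 /existsP[j1 /existsP[j2 /existsP[j3]]]]]].
  case/and5P=> /andP[l1 l2] l3 /andP[l4 l5] m1 /andP[m2 m3].
  have toE (a b : 'I_n.*2) : a < b -> [set a; b] \in blocks E -> (a, b) \in E.
    by move=> lt h; rewrite -(blocksK dE) inE /= lt h.
  have c1 : (i1, j1) \in E by apply: toE => //; move: l1 l2 l3; clear; lia.
  have c2 : (i2, j2) \in E by apply: toE => //; move: l2 l3 l4; clear; lia.
  have c3 : (i3, j3) \in E by apply: toE => //; move: l3 l4 l5; clear; lia.
  exact: (chord_no3 dE c1 c2 c3).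
apply/andP; split; last first.
  apply/forall_inP => _ /imsetP[e eE ->]; rewrite cards2.
  by have [e12|//] := eqVneq e.1 e.2; have := chord_lt dE eE; rewrite e12 ltnn.
apply/and3P; split.
- rewrite eqEsubset subsetT; apply/subsetP => x _; have [e eE ex] := chord_cover dE x.
  by apply/bigcupP; exists [set e.1; e.2]; [by apply/imsetP; exists e | rewrite !inE].
- apply/trivIsetP => _ _ /imsetP[e eE ->] /imsetP[f fE ->] ne.
  have nef : e != f by apply: contra_neq ne => ->.
  have /and4P[h1 h2 h3 h4] := chord_disjoint dE eE fE nef.
  rewrite -setI_eq0; apply/eqP/setP => x; rewrite !inE.
  by apply/negP => /andP[/orP[]/eqP -> /orP[]]; apply/negP.
- apply/negP => /imsetP[e eE e0]; have : e.1 \in (set0 : {set 'I_n.*2}) by rewrite e0 set21.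
  by rewrite inE.
Qed.

End Matchings.

(** * From matchings to fans *)

Section Weights.

Variable N : nat.
Notation chord := ('I_N * 'I_N)%type.
Implicit Types (E S : {set chord}).

Lemma weightE S k : weight S ord0 k = (if k == ord0 then #|S|%:Z else defect (@noncrossing N) S)%R.
Proof. by rewrite mxE. Qed.

Lemma weight_card S S' : weight S = weight S' -> #|S| = #|S'|.
Proof. by move/(congr1 (fun w : 'rV[int]_2 => w ord0 ord0)); rewrite !weightE eqxx => -[]. Qed.

Lemma weightU1 (e : chord) S k : e \notin S ->
  (`|weight (e |: S) ord0 k - weight S ord0 k| = 1)%R.
Proof.
move=> eS; rewrite !weightE; case: ifP => _; last exact: defectU1.
by rewrite cardsU1 eS add1n -addn1 PoszD addrC addKr.
Qed.

Variable E : {set chord}.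
Hypothesis dE : diagram E.

Lemma cut_square j : cut E j.+1 \subset square E j.
Proof.
apply/subsetP => e; rewrite !inE => /andP[-> /andP[h1 h2]] /=.
by case: ifP => _; [rewrite gtn_eqF | apply/andP; split; [exact: h1 | exact: ltnW]].
Qed.

Lemma weight_ge0 i k : (0 <= weight (cut E i) ord0 k)%R.
Proof.
case: i => [|i].
  have -> : cut E 0 = set0 by apply/setP => e; rewrite !inE ltn0 andbF.
  by rewrite weightE defect0 cards0; case: ifP.
have /andP[h1 h2] := weight_range dE (cut_square i).
by rewrite weightE; case: ifP.
Qed.

Lemma weight_sorted i (k l : 'I_2) : k <= l ->
  (weight (cut E i) ord0 l <= weight (cut E i) ord0 k)%R.
Proof.
case: i => [|i].
  have -> : cut E 0 = set0 by apply/setP => e; rewrite !inE ltn0 andbF.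
  by rewrite !weightE defect0 cards0; do 2!case: ifP.
have /andP[h1 h2] := weight_range dE (cut_square i).
by rewrite !weightE; case: k l => [[|[|//]] ?] [[|[|//]] ?].
Qed.

Lemma cut_step j : j < N -> exists2 q : chord, q \in E &
  (q.1 = j :> nat /\ q \notin cut E j /\ cut E j.+1 = q |: cut E j) \/
  (q.2 = j :> nat /\ q \notin cut E j.+1 /\ cut E j = q |: cut E j.+1).
Proof.
move=> jN; have [q qE hq] := chord_cover dE (Ordinal jN); exists q => //.
have lq := chord_lt dE qE.
have other (e : chord) : e \in E -> e != q -> e.1 <> j :> nat /\ e.2 <> j :> nat.
  move=> eE /(disjoint_chordsP dE eE qE)[h1 h2 h3 h4].
  by case/orP: hq => /eqP/(congr1 val) /= ->.
case/orP: hq => /eqP/(congr1 val) /= eq; [left|right]; (split; first by []); split.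
- by rewrite inE eq ltnn andbF.
- apply/setP => e; rewrite !inE; have [->|ne] := eqVneq e q.
    by rewrite qE eq ltnSn lq.
  case: (boolP (e \in E)) => //= eE; have [h1 h2] := other e eE ne.
  by move: h1 h2; clear; case: e => a b /=; lia.
- by rewrite inE eq ltnn !andbF.
- apply/setP => e; rewrite !inE; have [->|ne] := eqVneq e q.
    by rewrite qE eq lq leqnn.
  case: (boolP (e \in E)) => //= eE; have [h1 h2] := other e eE ne.
  by move: h1 h2; clear; case: e => a b /=; lia.
Qed.

(** Taking 0 out of the interval gains or loses its chord, according to the side of its partner;
so the first path before and after rotation determines the partner of 0. *)
Lemma card_cut1 (p : chord) j : p \in E -> p.1 = 0 :> nat -> 0 < j ->
  (#|cut E j| < #|cut1 E j|) = (p.2 < j).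
Proof.
move=> pE p1 j0.
have other (e : chord) : e \in E -> e != p -> (e.1 == 0 :> nat) = false.
  by move=> eE /(disjoint_chordsP dE eE pE)[h1 _ _ _]; apply/eqP; rewrite -p1.
have [pj|pj] := ltnP p.2 j.
  have -> : cut1 E j = p |: cut E j.
    apply/setP => e; rewrite !inE; have [->|ne] := eqVneq e p; first by rewrite pE p1 pj.
    by case: (boolP (e \in E)) => //= eE; rewrite other.
  have pc : p \notin cut E j by rewrite inE (leqNgt j) pj !andbF.
  by rewrite cardsU1 pc add1n ltnSn.
have -> : cut E j = p |: cut1 E j.
  apply/setP => e; rewrite !inE; have [->|ne] := eqVneq e p; first by rewrite pE p1 pj j0.
  by case: (boolP (e \in E)) => //= eE; rewrite other.
have pc : p \notin cut1 E j by rewrite inE p1 /= ltnNge pj andbF.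
by rewrite cardsU1 pc add1n ltnNge leqnSn.
Qed.

End Weights.

Section Encoding.

Variable n : nat.
Implicit Types (M : matching3 n) (F : fan 2 n).

(** A relation rather than a function, as it will be used in both directions. *)
Definition encodes M F := [forall i : 'I_n.*2.+1, mu F i == weight (cut (chords (val M)) i)].

Lemma encodesP M F :
  reflect (forall i, i <= n.*2 -> mu F i = weight (cut (chords (val M)) i)) (encodes M F).
Proof.
apply: (iffP forallP) => [h i lei|h i]; last by rewrite h // -ltnS.
exact: (eqP (h (Ordinal (lei : i < n.*2.+1)))).
Qed.

Lemma matching_perfect M : perfect_matching (val M).
Proof. by case/andP: (valP M). Qed.

Lemma matching_diagram M : diagram (chords (val M)).
Proof. by case/andP: (valP M) => h1 h2; exact: chords_diagram. Qed.

Lemma encodes_total M : exists F, encodes M F.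
Proof.
have dE := matching_diagram M; set E := chords _ in dE.
have [F hF] : exists F : fan 2 n, forall i, i <= n.*2 -> mu F i = weight (cut E i).
  apply: fan_of_mu.
  - have -> : cut E 0 = set0 by apply/setP => e; rewrite !inE ltn0 andbF.
    by apply/rowP => k; rewrite weightE defect0 cards0 mxE; case: ifP.
  - have -> : cut E n.*2 = set0 by apply/setP => e; rewrite !inE (leqNgt n.*2) !ltn_ord !andbF.
    by apply/rowP => k; rewrite weightE defect0 cards0 mxE; case: ifP.
  - by move=> i k _; exact: weight_ge0.
  - move=> i k lti; have [q qE [[_ [h1 ->]]|[_ [h1 ->]]]] := cut_step dE lti.
      exact: weightU1.
    by rewrite distrC; exact: weightU1.
  - by move=> i k l _; exact: weight_sorted.
by exists F; apply/encodesP.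
Qed.

Lemma encodes_rot M F j : encodes (rot_matching M) F -> 0 < j <= n.*2 ->
  mu F j.-1 = weight (cut1 (chords (val M)) j).
Proof.
move=> /encodesP h hj; rewrite h; last by case/andP: hj => _; exact/leq_trans/leq_pred.
rewrite /= chords_rot ?matching_perfect // weight_cut_rot //.
exact: matching_diagram.
Qed.

Lemma encodes_Pr M F : encodes M F -> encodes (rot_matching M) (Pr F).
Proof.
move=> encF; have [G encG] := encodes_total (rot_matching M).
suff -> : Pr F = G by [].
apply: Pr_eq => i /andP[i0 lti].
rewrite (encodes_rot (j := i.+1) encG) // (encodes_rot (j := i) encG) ?i0 ?(ltnW lti) //.
move/encodesP: encF => encF; rewrite !encF ?(ltnW lti) //.
by rewrite [(_ + weight (cut _ i.+1))%R]addrC local_rule ?i0 //; exact: matching_diagram.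
Qed.

Lemma encodes_fun M F F' : encodes M F -> encodes M F' -> F = F'.
Proof. by move=> /encodesP h /encodesP h'; apply: mu_inj => i lei; rewrite h ?h'. Qed.

Lemma encodes_zero M M' F (x y : 'I_n.*2) : encodes M F -> encodes M' F -> x = 0 :> nat ->
  [set x; y] \in val M -> [set x; y] \in val M'.
Proof.
move=> enc enc' x0 xyM; have dE := matching_diagram M; have dE' := matching_diagram M'.
have xy : x != y.
  apply: contraTneq xyM => ->; apply/negP => h.
  by have /andP[_ /forall_inP/(_ _ h)] := matching_perfect M; rewrite cards2 eqxx.
have pE : (x, y) \in chords (val M).
  by rewrite inE xyM /= x0 lt0n andbT -x0 eq_sym.
have [p pE' hp] := chord_cover dE' x.
have p1 : p.1 = x.
  case/orP: hp => /eqP // e; have := chord_lt dE' pE'.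
  by rewrite -e x0 ltn0.
have p10 : p.1 = 0 :> nat by rewrite p1.
have key j : 0 < j <= n.*2 -> (p.2 < j) = (y < j).
  move=> hj; have /andP[j0 jn] := hj.
  rewrite -(card_cut1 dE' pE' p10 j0) -(card_cut1 dE pE x0 j0).
  have c1 := encodesP _ _ enc j jn; rewrite (encodesP _ _ enc' j jn) in c1.
  have c2 := encodes_rot (encodes_Pr enc) hj; rewrite (encodes_rot (encodes_Pr enc') hj) in c2.
  by rewrite (weight_card c1) (weight_card c2).
have <- : p.2 = y.
  apply/val_inj/eqP; rewrite eqn_leq; apply/andP; split; rewrite -ltnS.
    by rewrite key ?ltnSn ?ltn_ord.
  by rewrite -key ?ltnSn ?ltn_ord.
by move: pE'; rewrite inE p1 => /andP[].
Qed.

(** Since promotion corresponds to rotation, a fan determines the fans of all rotated diagrams,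
hence the partner of every point, by rotating that point to 0. *)
Lemma encodes_inj M M' F : encodes M F -> encodes M' F -> M = M'.
Proof.
have main (k : nat) : forall M M' F (B : {set 'I_n.*2}) (x : 'I_n.*2),
    encodes M F -> encodes M' F -> B \in val M -> x \in B -> x = k :> nat -> B \in val M'.
  elim: k => [|k IHk] {}M {}M' {}F B x enc enc' BM xB xk.
    have /cards2P[a [b [ab eB]]] := forall_inP (andP (matching_perfect M)).2 B BM.
    rewrite eB in xB BM *; move: xB; rewrite !inE => /orP[]/eqP e; subst x.
      exact: encodes_zero enc enc' xk BM.
    by rewrite setUC; apply: encodes_zero enc enc' xk _; rewrite setUC.
  have BM' : (@ord_pred _ @: B) \in rot_set (val M) by apply: imset_f.
  have := IHk _ _ _ _ (ord_pred x) (encodes_Pr enc) (encodes_Pr enc') BM'.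
  rewrite imset_f // val_ord_pred xk /= => /(_ isT erefl) /imsetP[B' B'M /imset_inj].
  by move=> -> //; exact: ord_pred_inj.
move=> enc enc'; apply/val_inj/eqP; rewrite eqEsubset.
have ne (N : matching3 n) (B : {set 'I_n.*2}) : B \in val N -> exists x, x \in B.
  move=> BN; have := forall_inP (andP (matching_perfect N)).2 B BN.
  by move=> /eqP e; apply/set0Pn; rewrite -card_gt0 e.
apply/andP; split; apply/subsetP => B BN; have [x xB] := ne _ _ BN.
  exact: main _ _ _ _ _ _ enc enc' BN xB erefl.
exact: main _ _ _ _ _ _ enc' enc BN xB erefl.
Qed.

End Encoding.

(** * From fans to matchings: inverse insertion *)

Section Reconstruction.

Variable N : nat.
Notation chord := ('I_N * 'I_N)%type.
Implicit Types (e f : chord) (E : {set chord}) (R : {set 'I_N}).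

Definition below R (m : nat) := #|[set z in R | z < m]|.

Lemma belowS R R' m : R \subset R' -> below R m <= below R' m.
Proof.
move=> /subsetP sR; apply: subset_leq_card; apply/subsetP => z.
by rewrite !inE => /andP[/sR -> ->].
Qed.

Lemma below_eq R R' m : (forall z : 'I_N, z < m -> (z \in R) = (z \in R')) -> below R m = below R' m.
Proof.
move=> h; apply: eq_card => z; rewrite !inE; have [/h ->|] := ltnP z m => //.
by rewrite !andbF.
Qed.

Lemma below_all R m : (forall z : 'I_N, z \in R -> z < m) -> below R m = #|R|.
Proof.
by move=> h; apply: eq_card => z; rewrite inE; case: (boolP (z \in R)) => // /h ->.
Qed.

Lemma leq_below R m m' : m <= m' -> below R m <= below R m'.
Proof.
move=> le; apply: subset_leq_card; apply/subsetP => z.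
by rewrite !inE => /andP[-> lt]; exact: leq_trans le.
Qed.

Lemma belowD1 R (y : 'I_N) m : y \in R -> y < m -> below R m = (below (R :\ y) m).+1.
Proof.
move=> yR ym; rewrite /below (cardsD1 y) inE yR ym add1n; congr _.+1.
by apply: eq_card => z; rewrite !inE andbA.
Qed.

Lemma belowU1 R (y : 'I_N) m : y \notin R -> y < m -> below (y |: R) m = (below R m).+1.
Proof.
move=> yR ym; rewrite (@belowD1 _ y) ?setU11 //; congr _.+1; apply: below_eq => z _.
by rewrite !inE; case: eqVneq => // ->; rewrite (negbTE yR).
Qed.

Lemma below_lt R (y : 'I_N) : y \in R -> below R y < below R y.+1.
Proof.
move=> yR; rewrite (belowD1 yR (ltnSn y)) ltnS; apply: leq_trans (leq_below _ (leqnSn y)).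
rewrite leq_eqVlt (@below_eq _ (R :\ y)) ?eqxx // => z.
by rewrite !inE; case: eqVneq => // ->; rewrite ltnn.
Qed.

Lemma ex_max R : R != set0 -> exists2 y : 'I_N, y \in R & forall z : 'I_N, z \in R -> z <= y.
Proof.
case/set0Pn => x xR; case: (arg_maxnP (fun z : 'I_N => nat_of_ord z) xR) => y yR hy.
by exists y.
Qed.

(** A tableau with two rows, filled by some of the points before [i]. Sets encode its rows because
these increase; that the columns increase is expressed by counting, so that no position in a row
has to be mentioned. *)
Record tableau (a b : nat) (i : nat) R1 R2 : Prop := Tableau {
  tab_disjoint : forall z : 'I_N, z \in R1 -> z \in R2 -> False;
  tab_lt : forall z : 'I_N, z \in R1 :|: R2 -> z < i;
  tab_card1 : #|R1| = a;
  tab_card2 : #|R2| = b;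
  tab_column : forall z : 'I_N, z \in R2 -> below R2 z.+1 <= below R1 z }.

(** Row insertion of the letter [y] into the tableau [(R1', R2')] gives [(R1, R2)]. The two cases,
where [y] bumps a letter into the second row or is put at the end of the first one, are used only
through the consequences listed here. *)
Record unbump R1 R2 (y : 'I_N) R1' R2' : Prop := Unbump {
  unb_y : y \in R1;
  unb_yn : y \notin R1' :|: R2';
  unb_2 : R2' \subset R2;
  unb_1 : forall z : 'I_N, z \in R1' -> z \in R1 \/ forall p : 'I_N, p \in R2' -> p < z;
  unb_big : forall z p : 'I_N, z \in R1' -> y < z -> p \in R2' -> p < z;
  unb_bump : forall z : 'I_N, z \in R1' :|: R2' -> y < z -> exists2 p : 'I_N, p \in R2 & y < p <= z;
  unb_all : R1 :|: R2 = y |: (R1' :|: R2');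
  unb_le : forall m, m <= y -> below R1 m = below R1' m;
  unb_gt : forall m, y < m -> below R1 m = maxn (below R1' m) (below R1' y).+1 }.

(** Removing the last entry of the first row. *)
Lemma unbump_row1 a b i R1 R2 : tableau a.+1 b i R1 R2 -> b <= a ->
  exists y R1' R2', tableau a b i.+1 R1' R2' /\ unbump R1 R2 y R1' R2'.
Proof.
case=> disj lti c1 c2 col ba.
have [y yR ymax] : exists2 y : 'I_N, y \in R1 & forall z : 'I_N, z \in R1 -> z <= y.
  by apply: ex_max; rewrite -card_gt0 c1.
have cy : #|R1 :\ y| = a by have := cardsD1 y R1; rewrite c1 yR => -[->].
have yle m : m <= y -> below R1 m = below (R1 :\ y) m.
  move=> my; apply: below_eq => z zm; rewrite !inE; case: eqVneq => // zy.
  by move: zm; rewrite zy ltnNge my.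
have zlt (z : 'I_N) : z \in R1 :\ y -> z < y.
  rewrite !inE => /andP[zy zR]; rewrite ltn_neqAle ymax // andbT.
  by apply: contra_neq zy => /val_inj.
exists y, (R1 :\ y), R2; split; split=> //.
- by move=> z; rewrite !inE => /andP[_ zR]; exact: disj.
- move=> z zR; apply: ltnW; apply: lti; move: zR; rewrite !inE.
  by case/orP => [/andP[_ ->]//|->]; rewrite orbT.
- move=> z zR; have [zy|yz] := leqP z y; first by rewrite -yle // col.
  rewrite (below_all (R := R1 :\ y)); last by move=> x /zlt xy; exact: ltn_trans yz.
  rewrite cy; apply: leq_trans ba; rewrite -c2; apply: subset_leq_card.
  by apply/subsetP => x; rewrite inE => /andP[].
- rewrite !inE eqxx /=; apply/negP; exact: (disj y yR).
- by move=> z; rewrite !inE => /andP[_ ->]; left.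
- by move=> z p /zlt zy yz; move: (ltn_trans zy yz); rewrite ltnn.
- move=> z; rewrite inE => /orP[/zlt zy yz|zR yz]; last by exists z; rewrite ?yz ?leqnn.
  by move: (ltn_trans zy yz); rewrite ltnn.
- by rewrite setUA setD1K.
- move=> m ym; rewrite (belowD1 yR ym).
  have e1 : below (R1 :\ y) m = a.
    by rewrite below_all // => z /zlt zy; exact: ltn_trans ym.
  by rewrite e1 (below_all (m := y)) // cy; apply/esym/maxn_idPr.
Qed.

(** The last entry [q] of the second row goes back to the first one, in place of the greatest
entry [y] smaller than [q], which exists because columns increase. *)
Lemma unbump_row2 a b i R1 R2 : tableau a b.+1 i R1 R2 ->
  exists y R1' R2', tableau a b i.+1 R1' R2' /\ unbump R1 R2 y R1' R2'.
Proof.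
case=> disj lti c1 c2 col.
have [q qR qmax] : exists2 q : 'I_N, q \in R2 & forall z : 'I_N, z \in R2 -> z <= q.
  by apply: ex_max; rewrite -card_gt0 c2.
have bq : below R2 q.+1 = b.+1 by rewrite below_all // => z /qmax.
have colq := col q qR; rewrite bq in colq.
have [y yA ymax] : exists2 y : 'I_N, y \in [set z in R1 | z < q] &
    forall z : 'I_N, z \in [set z in R1 | z < q] -> z <= y.
  by apply: ex_max; rewrite -card_gt0; exact: leq_trans colq.
have [yR yq] : y \in R1 /\ y < q by move: yA; rewrite inE => /andP[].
have {}ymax (z : 'I_N) : z \in R1 -> z < q -> z <= y by move=> zR zq; apply: ymax; rewrite inE zR.
have qR1 : q \notin R1 by apply/negP => h; exact: disj h qR.
have qy : q \notin R1 :\ y by rewrite inE negb_and qR1 orbT.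
have ne_q (z : 'I_N) : z < q -> z != q by move=> zq; apply: contraTneq zq => ->; rewrite ltnn.
have R2lt (z : 'I_N) : z \in R2 :\ q -> z < q.
  rewrite !inE => /andP[zq zR]; rewrite ltn_neqAle qmax // andbT.
  by apply: contra_neq zq => /val_inj.
have yle m : m <= y -> below R1 m = below (q |: (R1 :\ y)) m.
  move=> my; apply: below_eq => z zm; have zy := leq_trans zm my.
  rewrite !inE (negbTE (ne_q _ (ltn_trans zy yq))) /=.
  by have -> : z != y by apply: contraTneq zy => ->; rewrite ltnn.
(* Between [y] and [q] the first row has no entry. *)
have gap m : y < m -> m <= q -> below R1 m = (below R1 y).+1.
  move=> ym mq; rewrite (belowD1 yR ym); congr _.+1.
  apply: eq_card => z; rewrite !inE; have [->|zy] := eqVneq z y; first by rewrite ltnn andbF.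
  case: (boolP (z \in R1)) => //= zR; apply/idP/idP => [zm|zly]; last exact: ltn_trans ym.
  rewrite ltn_neqAle (ymax z zR (leq_trans zm mq)) andbT.
  by apply: contra_neq zy => /val_inj.
have out m : y < m -> m <= q -> below (q |: (R1 :\ y)) m = below R1 y.
  move=> ym mq; apply/eqP; rewrite -eqSS -(gap m) // (belowD1 yR ym) eqSS; apply/eqP.
  by apply: below_eq => z zm; rewrite !inE (negbTE (ne_q _ (leq_trans zm mq))).
exists y, (q |: (R1 :\ y)), (R2 :\ q); split; split.
- move=> z; rewrite !inE => /orP[/eqP ->|/andP[_ zR]]; first by rewrite eqxx.
  by move=> /andP[_]; exact: disj.
- move=> z zR; apply: ltnW; apply: lti; move: zR; rewrite !inE.
  by case/orP => [/orP[/eqP ->|/andP[_ ->]//]|/andP[_ ->]]; rewrite ?qR ?orbT.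
- by rewrite cardsU1 qy -c1 (cardsD1 y R1) yR.
- by have := cardsD1 q R2; rewrite c2 qR => -[].
- move=> z zR; have zq := R2lt z zR; have zR2 : z \in R2 by move: zR; rewrite inE => /andP[].
  have [zy|yz] := leqP z y.
    by rewrite -yle //; apply: leq_trans (col z zR2); apply: belowS; rewrite subsetDl.
  rewrite out ?(ltnW zq) // -ltnS -(gap q) //; apply: leq_trans colq; rewrite ltnS.
  apply: leq_trans (_ : #|R2 :\ q| <= _).
    by apply: subset_leq_card; apply/subsetP => x; rewrite inE => /andP[].
  by have := cardsD1 q R2; rewrite c2 qR => -[->].
- by [].
- have yR2 : y \notin R2 by apply/negP => h; exact: (disj y yR).
  by rewrite !inE eqxx (negbTE yR2) (negbTE (ne_q y yq)) andbF.
- exact: subsetDl.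
- move=> z; rewrite !inE => /orP[/eqP ->|/andP[_ ->]]; [right=> p; exact: R2lt | by left].
- move=> z p; rewrite !inE => /orP[/eqP -> _|/andP[_ zR] yz pR].
    by move=> h; apply: R2lt; rewrite !inE.
  have pq : p < q by apply: R2lt; rewrite !inE.
  apply: leq_trans pq _; rewrite leqNgt; apply/negP => zq.
  by have := ymax z zR zq; rewrite leqNgt yz.
- move=> z; rewrite !inE => /orP[/orP[/eqP -> yz|/andP[_ zR] yz]|/andP[zq zR] yz].
  + by exists q; rewrite ?yq ?leqnn.
  + exists q => //; rewrite yq leqNgt; apply/negP => zq.
    by have := ymax z zR zq; rewrite leqNgt yz.
  + by exists z; rewrite ?yz ?leqnn.
- apply/setP => z; rewrite !inE; have [->|zy] := eqVneq z y; first by rewrite yR.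
  by have [->|zq] := eqVneq z q; rewrite ?qR ?orbT.
- by [].
- move=> m ym; rewrite -(yle y) //; have [mq|qm] := leqP m q.
    by rewrite out // gap //; apply/esym/maxn_idPr.
  have -> : below (q |: R1 :\ y) m = below R1 m by rewrite belowU1 // -belowD1.
  by apply/esym/maxn_idPl; apply: leq_trans (below_lt yR) (leq_below _ ym).
Qed.

Lemma tableau_up1 a b R1 R2 (x : 'I_N) :
  tableau a b x R1 R2 -> tableau a.+1 b x.+1 (x |: R1) R2.
Proof.
case=> disj lti c1 c2 col.
have xR : x \notin R1 :|: R2 by apply/negP => /lti; rewrite ltnn.
move: xR; rewrite inE negb_or => /andP[xR1 xR2]; split.
- by move=> z /setU1P[-> xR|]; [rewrite xR in xR2 | exact: disj].
- move=> z; rewrite -setUA => /setU1P[-> //|/lti]; exact: ltnW.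
- by rewrite cardsU1 xR1 c1.
- by [].
- by move=> z zR; apply: leq_trans (col z zR) (belowS _ _); exact: subsetUr.
Qed.

Lemma tableau_up2 a b R1 R2 (x : 'I_N) :
  b < a -> tableau a b x R1 R2 -> tableau a b.+1 x.+1 R1 (x |: R2).
Proof.
move=> ba [disj lti c1 c2 col].
have xR : x \notin R1 :|: R2 by apply/negP => /lti; rewrite ltnn.
move: xR; rewrite inE negb_or => /andP[xR1 xR2]; split.
- by move=> z zR /setU1P[e|]; [rewrite e (negbTE xR1) in zR | exact: disj].
- move=> z; rewrite setUCA => /setU1P[-> //|/lti]; exact: ltnW.
- by [].
- by rewrite cardsU1 xR2 c2.
- move=> z /setU1P[->|zR].
    rewrite (below_all (R := R1)) ?c1.
      rewrite belowU1 //; apply: leq_trans ba; rewrite ltnS -c2.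
      by apply: subset_leq_card; apply/subsetP => y; rewrite inE => /andP[].
    by move=> y yR; apply: lti; rewrite inE yR.
  apply: leq_trans (col z zR); rewrite leq_eqVlt (@below_eq _ R2) ?eqxx // => y yz.
  rewrite !inE; case: eqVneq yz => // ->; rewrite ltnS leqNgt lti //.
  by rewrite inE zR orbT.
Qed.

Variables A B : nat -> nat.

(** A matching of the entries of a tableau and of the points from [i] on, in which no two entries
are partners: the entries are the openers of the chords that are open at [i]. Reading these
openers by decreasing closers gives a word, of which [(R1, R2)] is the insertion tableau. This is
expressed by [cmp_below], a form of Schensted's theorem for the letters smaller than [m], and by
[cmp_cross], which concerns the descents of the word: if [e.1] comes after the greater letter
[f.1], then it is still in the first row, and a letter of the second row lies between them. The
latter keeps a third row from appearing, hence three chords from crossing pairwise. *)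
Record completion (i : nat) R1 R2 E : Prop := Completion {
  cmp_lt : forall e : chord, e \in E -> e.1 < e.2;
  cmp_late : forall e : chord, e \in E -> i <= e.2;
  cmp_open : forall e : chord, e \in E -> e.1 < i -> e.1 \in R1 :|: R2;
  cmp_cover : forall x : 'I_N, (x \in R1 :|: R2) || (i <= x) ->
    exists2 e : chord, e \in E & (x == e.1) || (x == e.2);
  cmp_disjoint : forall e f : chord, e \in E -> f \in E -> e != f -> disjoint_chords e f;
  cmp_no3 : forall e f g : chord, e \in E -> f \in E -> g \in E ->
    e.1 < f.1 -> f.1 < g.1 -> g.1 < e.2 -> e.2 < f.2 -> f.2 < g.2 -> False;
  cmp_cuts : forall j, i <= j <= N ->
    #|cut E j| = A j + B j /\ maxchain (@noncrossing N) (cut E j) = A j;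
  cmp_below : forall m,
    maxchain (@noncrossing N) [set e in cut E i | e.1 < m] = below R1 m;
  cmp_cross : forall e f : chord, e \in E -> f \in E -> e.1 < f.1 -> f.1 < i -> e.2 < f.2 ->
    e.1 \in R1 /\ exists2 p : 'I_N, p \in R2 & e.1 < p <= f.1 }.

Lemma maxchain_cut i R1 E : #|R1| = A i -> (forall z : 'I_N, z \in R1 -> z < i) ->
  (forall m, maxchain (@noncrossing N) [set e in cut E i | e.1 < m] = below R1 m) ->
  maxchain (@noncrossing N) (cut E i) = A i.
Proof.
move=> c1 lti below1; rewrite -c1 -(below_all lti) -below1; congr maxchain.
by apply/setP => e; rewrite !inE; case: (e \in E) => //=; case: (e.1 < i); rewrite ?andbF ?andbT.
Qed.

(** Read backwards, an opener [x] is the greatest letter of the word, and deleting it commutes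
with insertion. *)
Lemma completion_up R1 R2 R1' R2' E (x : 'I_N) :
  #|R1| = A x -> A x.+1 + B x.+1 = (A x + B x).+1 ->
  (forall z : 'I_N, z \in R1 :|: R2 -> z < x) ->
  R1 \subset R1' -> R2 \subset R2' -> R1' :|: R2' = x |: (R1 :|: R2) ->
  (forall z : 'I_N, z \in R1' -> z < x -> z \in R1) ->
  (forall z : 'I_N, z \in R2' -> z < x -> z \in R2) ->
  completion x.+1 R1' R2' E -> completion x R1 R2 E.
Proof.
move=> c1 cAB ltx s1 s2 sU b1 b2 [lt late open cover disj no3 cuts bel cross].
have b12 (z : 'I_N) : z \in R1' :|: R2' -> z < x -> z \in R1 :|: R2.
  by rewrite !inE => /orP[/b1 h|/b2 h] /h ->; rewrite ?orbT.
have below1 m : maxchain (@noncrossing N) [set e in cut E x | e.1 < m] = below R1 m.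
  transitivity (below R1' (minn m x)).
    rewrite -bel; congr maxchain; apply/setP => e; rewrite !inE.
    case: (boolP (e \in E)) => //= eE; have := late e eE.
    by clear; case: e => c d /=; lia.
  have -> : below R1' (minn m x) = below R1 (minn m x).
    apply: below_eq => z; rewrite leq_min => /andP[_ zx].
    by apply/idP/idP => [/b1|/(subsetP s1)] //; apply.
  apply: eq_card => z; rewrite !inE leq_min; case: (boolP (z \in R1)) => //= zR.
  by rewrite ltx ?andbT // inE zR.
have xR : x \notin R1 :|: R2 by apply/negP => /ltx; rewrite ltnn.
split=> //.
- by move=> e /late; exact: ltnW.
- by move=> e eE ex; apply: b12 => //; apply: open => //; exact: ltnW.
- move=> z hz; apply: cover; rewrite sU; case/orP: hz => [hz|].
    by rewrite inE hz orbT.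
  by rewrite leq_eqVlt => /orP[/eqP/val_inj <-|->]; rewrite ?setU11 ?orbT.
- move=> j /andP[xj jN]; move: xj; rewrite leq_eqVlt => /orP[/eqP <-|xj]; last first.
    by apply: cuts; rewrite xj.
  split; last by apply: maxchain_cut below1 => // z zR; apply: ltx; rewrite inE zR.
  have [|c _] := cuts x.+1; first by rewrite leqnn ltn_ord.
  rewrite cAB in c.
  have [|e0 e0E e0x] := cover x; first by rewrite sU setU11.
  have e01 : e0.1 = x.
    case/orP: e0x => /eqP // e; have := late e0 e0E.
    by rewrite -e ltnn.
  have e0n : e0 \notin cut E x by rewrite inE e01 ltnn andbF.
  apply/eqP; rewrite -eqSS -c; apply/eqP.
  rewrite (_ : cut E x.+1 = e0 |: cut E x) ?cardsU1 ?e0n //.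
  apply/setP => e; rewrite !inE; have [->|ne] := eqVneq e e0.
    by rewrite e0E e01 ltnSn late.
  case: (boolP (e \in E)) => //= eE; have := late e eE.
  have /and4P[h _ _ _] := disj e e0 eE e0E ne; move: h; rewrite e01 => h.
  have : e.1 <> x :> nat by move=> /val_inj eq; rewrite eq eqxx in h.
  by clear; case: e => c d /=; lia.
- move=> e f eE fE ef fx ef2.
  have [h1 [p pR hp]] := cross e f eE fE ef (ltnW fx) ef2.
  split; first by apply: b1 => //; exact: ltn_trans fx.
  exists p => //; apply: b2 => //; case/andP: hp => _ pf; exact: leq_ltn_trans fx.
Qed.

(** Read backwards, a closer [x] appends the letter [y] to the word: its chord is nested inside the
chords with a smaller opener and crosses the others. *)
Lemma completion_down R1 R2 R1' R2' E (x y : 'I_N) :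
  #|R1| = A x -> A x + B x = (A x.+1 + B x.+1).+1 ->
  (forall z : 'I_N, z \in R1 :|: R2 -> z < x) ->
  unbump R1 R2 y R1' R2' ->
  completion x.+1 R1' R2' E -> completion x R1 R2 ((y, x) |: E).
Proof.
move=> c1 cAB ltx [yR1 yn s2 u1 ubig ubump uall ule ugt]
  [lt late open cover disj no3 cuts bel cross].
have yx : y < x by apply: ltx; rewrite inE yR1.
have sub (z : 'I_N) : z \in R1' :|: R2' -> z < x.
  by move=> h; apply: ltx; rewrite uall inE h orbT.
have E1 e : e \in E -> (e.1 \in R1' :|: R2') || (x < e.1).
  move=> eE; have [h|_] := leqP e.1 x; last by rewrite orbT.
  by rewrite open.
have E1x e : e \in E -> e.1 != x.
  move=> /E1 /orP[/sub|]; apply: contraTneq => ->; by rewrite ltnn.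
have E1y e : e \in E -> e.1 != y.
  move=> /E1 /orP[h|]; first by apply: contraNneq yn => <-.
  by apply: contraTneq => ->; rewrite -leqNgt ltnW.
have E2 e : e \in E -> x < e.2 by move=> /late.
have yxE : (y, x) \notin E by apply/negP => /E2; rewrite ltnn.
have E1lt e : e \in E -> (e.1 < x.+1) = (e.1 < x).
  by move=> /E1x ne; rewrite ltnS leq_eqVlt (negbTE (_ : e.1 != x :> nat)).
have cutj j : x < j -> cut ((y, x) |: E) j = cut E j.
  move=> xj; apply/setP => e; rewrite !inE; have [->|//] := eqVneq e (y, x).
  by rewrite (negbTE yxE) /= (leqNgt j) xj andbF.
have cutx : cut ((y, x) |: E) x = (y, x) |: cut E x.+1.
  apply/setP => e; rewrite !inE; have [->|ne] := eqVneq e (y, x); first by rewrite yx leqnn.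
  case: (boolP (e \in E)) => //= eE; rewrite E1lt //.
  by have := E2 e eE; move=> h; rewrite h (ltnW h).
have below1 m : maxchain (@noncrossing N) [set e in cut ((y, x) |: E) x | e.1 < m] = below R1 m.
  rewrite cutx; have [my|ym] := leqP m y.
    rewrite ule // -bel; congr maxchain; apply/setP => e; rewrite !inE.
    have [->|//] := eqVneq e (y, x).
    by rewrite (negbTE yxE) /= ltnNge my.
  rewrite ugt // -!bel.
  have -> : [set e in (y, x) |: cut E x.+1 | e.1 < m] =
      (y, x) |: [set e in cut E x.+1 | e.1 < m].
    by apply/setP => e; rewrite !inE; have [->|] := eqVneq e (y, x); rewrite //= ym.
  rewrite maxchainU1_sym; last first.
  - by rewrite !inE (negbTE yxE).
  - by move=> e _; rewrite /noncrossing andbC.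
  congr (maxn _ (maxchain _ _).+1); apply/setP => e; rewrite !inE.
  case: (boolP (e \in E)) => //= eE.
  have := E1y e eE => ney; have ney' : e.1 <> y :> nat by move/val_inj => h; rewrite h eqxx in ney.
  have := E1x e eE => nex; have nex' : e.1 <> x :> nat by move/val_inj => h; rewrite h eqxx in nex.
  have := E2 e eE; move: ney' nex' ym yx; clear; rewrite /noncrossing /=.
  by case: e => c d /=; lia.
split.
- by move=> e /setU1P[->|/lt].
- by move=> e /setU1P[->//|/E2/ltnW].
- move=> e /setU1P[->|eE] ex; first by rewrite inE yR1.
  by rewrite uall inE open ?orbT // ltnW.
- move=> z; rewrite uall; have [->|zy] := eqVneq z y.
    by exists (y, x); rewrite ?setU11 // eqxx.
  have [->|zx] := eqVneq z x.
    by exists (y, x); rewrite ?setU11 // eqxx orbT.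
  rewrite inE in_set1 (negbTE zy) leq_eqVlt [x == z :> nat]eq_sym (negbTE (_ : z != x :> nat)) // => h.
  by have [e eE he] := cover z h; exists e; rewrite // inE eE orbT.
- have yxd e : e \in E -> [/\ e.1 != y, e.1 != x, e.2 != y & e.2 != x].
    move=> eE; split; [exact: E1y | exact: E1x | |].
      by apply: contraTneq (E2 e eE) => ->; rewrite -leqNgt ltnW.
    by apply: contraTneq (E2 e eE) => ->; rewrite ltnn.
  move=> e f /setU1P[->|eE] /setU1P[->|fE]; rewrite ?eqxx // => ne.
  + have [h1 h2 h3 h4] := yxd f fE.
    by rewrite /disjoint_chords /= ![y == _]eq_sym ![x == _]eq_sym h1 h2 h3 h4.
  + by have [h1 h2 h3 h4] := yxd e eE; rewrite /disjoint_chords /= h1 h2 h3 h4.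
  + exact: disj.
- move=> e f g /setU1P[->|eE] /setU1P[->|fE] /setU1P[->|gE] //=; rewrite ?ltnn // => h1 h2 h3 h4 h5.
  + by have := ltn_trans h1 h2; rewrite ltnn.
  + have [f1 [p pR /andP[p1 p2]]] := cross f g fE gE h2 (ltnW h3) h5.
    have := ubig _ p f1 h1 pR; by rewrite ltnNge ltnW.
  + by have := ltn_trans (E2 e eE) h4; rewrite ltnn.
  + by have := ltn_trans (E2 f fE) h5; rewrite ltnn.
  + exact: (no3 e f g).
- move=> j /andP[xj jN]; move: xj; rewrite leq_eqVlt => /orP[/eqP <-|xj]; last first.
    by rewrite cutj //; apply: cuts; rewrite xj.
  split; last by apply: maxchain_cut below1 => // z zR; apply: ltx; rewrite inE zR.
  have [|c _] := cuts x.+1; first by rewrite leqnn ltn_ord.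
  by rewrite cutx cardsU1 inE (negbTE yxE) /= c cAB.
- by [].
- move=> e f /setU1P[->|eE] /setU1P[->|fE] //=; rewrite ?ltnn // => ef fx ef2.
  + split=> //; apply: ubump => //; apply: open => //; exact: ltnW.
  + by have := ltn_trans (E2 e eE) ef2; rewrite ltnn.
  + have [h1 [p pR hp]] := cross e f eE fE ef (ltnW fx) ef2.
    split; last by exists p => //; exact: (subsetP s2).
    case: (u1 _ h1) => // /(_ p pR); case/andP: hp => hp _.
    by rewrite ltnNge ltnW.
Qed.

(** The tableau is followed forwards along the sequence of shapes, [x] being added when it opens a
chord and a letter being unbumped and matched with [x] otherwise; the chords are collected on the
way back. *)
Lemma completion_ex i R1 R2 :
  (forall j, j <= N -> B j <= A j) -> A N = 0 -> B N = 0 ->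
  (forall j, j < N -> [\/ A j.+1 = (A j).+1 /\ B j.+1 = B j, A j = (A j.+1).+1 /\ B j.+1 = B j,
     A j.+1 = A j /\ B j.+1 = (B j).+1 | A j.+1 = A j /\ B j = (B j.+1).+1]) ->
  i <= N -> tableau (A i) (B i) i R1 R2 -> exists E, completion i R1 R2 E.
Proof.
move=> leBA AN BN step leiN; rewrite -(subKn leiN).
elim: (N - i) (leq_subr i N) R1 R2 => [_|k IHk kN] R1 R2 tab.
  rewrite subn0 in tab *; have [disj lti c1 c2 col] := tab; exists set0.
  have R0 : R1 = set0 by apply/eqP; rewrite -cards_eq0 c1 AN.
  have R0' : R2 = set0 by apply/eqP; rewrite -cards_eq0 c2 BN.
  have cut0 j : cut set0 j = set0 :> {set chord} by apply/setP => e; rewrite !inE.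
  rewrite R0 R0'; split; try by move=> e; rewrite inE.
  - by move=> x; rewrite !inE /= leqNgt ltn_ord.
  - by move=> j; rewrite -eqn_leq => /eqP <-; rewrite AN BN cut0 cards0 maxchain0.
  - move=> m; rewrite below_all => [|z]; last by rewrite inE.
    rewrite cards0 (_ : [set e in _ | _] = set0) ?maxchain0 //.
    by apply/setP => e; rewrite !inE.
have iN : N - k.+1 < N by move: kN; clear; lia.
have ik : (N - k.+1).+1 = N - k by move: kN; clear; lia.
pose x := Ordinal iN; rewrite -[N - k.+1]/(val x) in tab *.
rewrite -ik -[(N - k.+1)]/(val x) in IHk.
have {}IHk := IHk (ltnW kN).
have [disj ltx c1 c2 col] := tab.
have oldU R (z : 'I_N) : z \in x |: R -> z < x -> z \in R.
  by case/setU1P => // ->; rewrite ltnn.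
case: (step x (ltn_ord x)) => -[eA eB].
- have tab' := tableau_up1 tab; rewrite -eA -eB in tab'.
  have [E hE] := IHk _ _ tab'; exists E.
  apply: completion_up hE => //; rewrite ?subsetUr ?eA ?eB ?addSn //.
  + by rewrite setUA.
  + exact: oldU.
- rewrite eA -eB in tab; have [|y [R1' [R2' [tab' unb]]]] := unbump_row1 tab.
    by rewrite leBA.
  have [E hE] := IHk _ _ tab'; exists ((y, x) |: E).
  by apply: completion_down unb hE => //; rewrite eA eB addSn.
- have ba : B x < A x by rewrite -eA -eB leBA.
  have tab' := tableau_up2 ba tab; rewrite -eA -eB in tab'.
  have [E hE] := IHk _ _ tab'; exists E.
  apply: completion_up hE => //; rewrite ?subsetUr ?eA ?eB ?addnS //.
  + by rewrite setUCA.
  + exact: oldU.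
- rewrite -eA eB in tab; have [y [R1' [R2' [tab' unb]]]] := unbump_row2 tab.
  have [E hE] := IHk _ _ tab'; exists ((y, x) |: E).
  by apply: completion_down unb hE => //; rewrite eA eB addnS.
Qed.

Lemma diagram_ex :
  (forall j, j <= N -> B j <= A j) -> A 0 = 0 -> B 0 = 0 -> A N = 0 -> B N = 0 ->
  (forall j, j < N -> [\/ A j.+1 = (A j).+1 /\ B j.+1 = B j, A j = (A j.+1).+1 /\ B j.+1 = B j,
     A j.+1 = A j /\ B j.+1 = (B j).+1 | A j.+1 = A j /\ B j = (B j.+1).+1]) ->
  exists E, diagram E /\ forall j, j <= N ->
    #|cut E j| = A j + B j /\ maxchain (@noncrossing N) (cut E j) = A j.
Proof.
move=> leBA A0 B0 AN BN step.
have [||E [lt _ _ cover disj no3 cuts _ _]] := @completion_ex 0 set0 set0 leBA AN BN step.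
- by [].
- split; try by move=> z; rewrite !inE.
  + by rewrite cards0 A0.
  + by rewrite cards0 B0.
by exists E; split=> //; split=> // x; apply: cover; rewrite orbT.
Qed.

End Reconstruction.

(** * The bijection *)

Lemma encodes_onto (n : nat) (F : fan 2 n) : exists M : matching3 n, encodes M F.
Proof.
pose k0 : 'I_2 := ord0; pose k1 : 'I_2 := lift ord0 ord0.
pose d k j := `|mu F j ord0 k|%N.
have dE k j : j <= n.*2 -> mu F j ord0 k = (d k j)%:Z%R.
  by move=> lej; rewrite /d; have := height_ge0 (tnth (val F) k) lej; rewrite mxE; clear; lia.
have d_odd k j : j <= n.*2 -> odd (d k j) = odd j.
  by move=> lej; rewrite /d mxE height_odd.
have d_le j : j <= n.*2 -> d k1 j <= d k0 j.
  by move=> lej; have := mu_sorted F lej (leq0n k1 : k0 <= k1); rewrite !dE.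
have d_step k j : j < n.*2 -> d k j.+1 = (d k j).+1 \/ d k j = (d k j.+1).+1.
  move=> ltj; have := dE k _ ltj; have := dE k _ (ltnW ltj); rewrite !mxE heightS // => ->.
  by case: ifP => _; clear; lia.
have d0 k : d k 0 = 0 by rewrite /d mxE height0.
have dl k : d k n.*2 = 0 by rewrite /d mxE height_last.
(* The two row lengths, from their sum and difference. *)
pose a j := (d k0 j + d k1 j)./2; pose b j := (d k0 j - d k1 j)./2.
have ab j : j <= n.*2 -> a j + b j = d k0 j /\ a j = b j + d k1 j.
  move=> lej; rewrite /a /b; have := d_le j lej; have := d_odd k0 j lej; have := d_odd k1 j lej.
  by clear; lia.
have [||||||E [dE' hE]] := @diagram_ex n.*2 a b.
- by move=> j /ab[_ ->]; exact: leq_addr.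
- by rewrite /a !d0.
- by rewrite /b !d0.
- by rewrite /a !dl.
- by rewrite /b !dl.
- move=> j ltj; have [s1 s2] := ab _ (ltnW ltj); have [t1 t2] := ab _ ltj.
  move: (d_step k0 j ltj) (d_step k1 j ltj) s1 s2 t1 t2; clear.
  move: (a j) (b j) (a j.+1) (b j.+1) (d k0 j) (d k1 j) (d k0 j.+1) (d k1 j.+1); clear.
  move=> a b a' b' d0 d1 d0' d1' [] e0 [] e1 s1 s2 t1 t2;
    [apply: Or41|apply: Or43|apply: Or44|apply: Or42]; lia.
exists (exist _ (blocks E) (blocks_matching dE')); apply/encodesP => j lej /=.
rewrite blocksK //; apply/rowP => k; have [c m] := hE j lej; have [s t] := ab j lej.
rewrite dE // weightE /defect c m.
have [->|nk] := eqVneq k ord0; first by rewrite s.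
have -> : k = k1 by move: nk; case: k => [[|[|//]] ?] //= _; exact/val_inj.
by rewrite s; move: s t; clear; generalize (a j) (b j) (d k0 j) (d k1 j); lia.
Qed.

Theorem theorem3p7 (n : nat) (hn : (1 <= n)%N) :
  exists Psi : fan 2 n -> matching3 n,
    bijective Psi /\
    (forall F : fan 2 n, Psi (Pr F) = rot_matching (Psi F)).
Proof.
pose Psi F := xchoose (@encodes_onto n F); pose Phi M := xchoose (@encodes_total n M).
have PsiP F : encodes (Psi F) F by exact: xchooseP (encodes_onto F).
have PhiP M : encodes M (Phi M) by exact: xchooseP (encodes_total M).
exists Psi; split.
  exists Phi => [F|M]; first exact: encodes_fun (PhiP _) (PsiP F).
  exact: encodes_inj (PsiP _) (PhiP M).
by move=> F; apply: encodes_inj (PsiP _) (encodes_Pr (PsiP F)).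
Qed.
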